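(* Let $p$ and $q$ be distinct odd primes and let $E_{-2pq}$ be the elliptic curve $y^2=x^3-2pqx$ over $\mathbb{Q}$. (i) If $(p,q)\equiv(3,3)\pmod 8$ and $pq-32$ is a perfect square, then $\operatorname{rank}(E_{-2pq}(\mathbb{Q}))=1$, both when $\left(\frac{p}{q}\right)=1$ and when $\left(\frac{p}{q}\right)=-1$. (ii) If $(p,q)\equiv(3,5)\pmod 8$, then $\operatorname{rank}(E_{-2pq}(\mathbb{Q}))=1$ whenever either $\left(\frac{p}{q}\right)=1$ and $p-2q$ is a perfect square, or $\left(\frac{p}{q}\right)=-1$ and $2p-q$ is a perfect square. (iii) If $(p,q)\equiv(5,3)\pmod 8$, then $\operatorname{rank}(E_{-2pq}(\mathbb{Q}))=1$ whenever either $\left(\frac{p}{q}\right)=1$ and $q-2p$ is a perfect square, or $\left(\frac{p}{q}\right)=-1$ and $2q-p$ is a perfect square. (iv) If $(p,q)\equiv(3,7)\pmod 8$, then $\operatorname{rank}(E_{-2pq}(\mathbb{Q}))=1$ whenever either $\left(\frac{p}{q}\right)=1$ and $32p-q$ is a perfect square, or $\left(\frac{p}{q}\right)=-1$ and $q-2p$ is a perfect square. (v) If $(p,q)\equiv(7,3)\pmod 8$, then $\operatorname{rank}(E_{-2pq}(\mathbb{Q}))=1$ whenever either $\left(\frac{p}{q}\right)=1$ and $p-2q$ is a perfect square, or $\left(\frac{p}{q}\right)=-1$ and $32q-p$ is a perfect square. (vi) If $(p,q)\equiv(5,7)\pmod 8$, then $\operatorname{rank}(E_{-2pq}(\mathbb{Q}))=1$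 whenever either $\left(\frac{p}{q}\right)=1$ and $32p-q$ is a perfect square, or $\left(\frac{p}{q}\right)=-1$ and $2q-p$ is a perfect square. (vii) If $(p,q)\equiv(7,5)\pmod 8$, then $\operatorname{rank}(E_{-2pq}(\mathbb{Q}))=1$ whenever either $\left(\frac{p}{q}\right)=1$ and $32q-p$ is a perfect square, or $\left(\frac{p}{q}\right)=-1$ and $2p-q$ is a perfect square. (viii) If $(p,q)\equiv(5,5)\pmod 8$ and $2pq-1$ is a perfect square, then $\operatorname{rank}(E_{-2pq}(\mathbb{Q}))=1$, both when $\left(\frac{p}{q}\right)=1$ and when $\left(\frac{p}{q}\right)=-1$.
   Context: $\left(\frac{p}{q}\right)$ denotes the Legendre symbol; $(p,q)\equiv(a,b)\pmod 8$ means $p\equiv a$ and $q\equiv b\pmod 8$. ''Perfect square'' means the square of an integer. $\operatorname{rank}(E(\mathbb{Q}))$ is the Mordell--Weil rank. No conjecture is assumed. *)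

(* Defs.v *)
From HB Require Import structures.
From mathcomp Require Import all_boot all_order all_algebra.
From mathcomp Require Import ring.

Set Implicit Arguments.
Unset Strict Implicit.
Unset Printing Implicit Defensive.

Import Order.TTheory GRing.Theory Num.Theory.

Local Open Scope ring_scope.

(* Rational points of y^2 = x^3 + a x + b; [None] is the point at infinity. *)
Definition on_curve (a b : rat) (P : option (rat * rat)) : bool :=
  if P is Some (x, y) then y ^+ 2 == x ^+ 3 + a * x + b else true.

Record point (a b : rat) : Type := Point {
  pt_val : option (rat * rat);
  pt_on_curve : on_curve a b pt_val
}.

(* Chord-and-tangent law. When x1 = x2 and y1 != - y2, both points being on the
   curve, y1 = y2 != 0 and the slope is that of the tangent line. *)
Definition add_raw (a : rat) (P Q : option (rat * rat)) : option (rat * rat) :=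
  match P, Q with
  | None, _ => Q
  | _, None => P
  | Some (x1, y1), Some (x2, y2) =>
      if (x1 == x2) && (y1 == - y2) then None else
      let s := if x1 == x2 then (3 * x1 ^+ 2 + a) / (2 * y1)
               else (y2 - y1) / (x2 - x1) in
      let x3 := s ^+ 2 - x1 - x2 in
      Some (x3, s * (x1 - x3) - y1)
  end.

Definition opp_raw (P : option (rat * rat)) : option (rat * rat) :=
  if P is Some (x, y) then Some (x, - y) else None.

Lemma add_raw_on_curve a b P Q :
  on_curve a b P -> on_curve a b Q -> on_curve a b (add_raw a P Q).
Proof.
case: P => [[x1 y1]|] //; case: Q => [[x2 y2]|] //= /eqP e1 /eqP e2.
have [ex|nx] := eqVneq x1 x2 => /=.
  subst x2; have [//|ny] := eqVneq y1 (- y2).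
  have ey : y1 = y2.
    apply/eqP; rewrite -subr_eq0.
    have /eqP : (y1 - y2) * (y1 + y2) = 0 by rewrite -subr_sqr e1 e2 subrr.
    by rewrite mulf_eq0 => /orP[//|]; rewrite (addr_eq0 y1 y2) (negPf ny).
  subst y2.
  have y0 : y1 != 0 by apply: contra ny => /eqP ->; rewrite oppr0.
  have eb : b = y1 ^+ 2 - x1 ^+ 3 - a * x1 by rewrite e1; ring.
  by apply/eqP; rewrite eb; field.
have nz : x2 - x1 != 0 by rewrite subr_eq0 eq_sym.
have ea : a = (y2 ^+ 2 - y1 ^+ 2 - x2 ^+ 3 + x1 ^+ 3) / (x2 - x1).
  by rewrite e1 e2; field.
have eb : b = y1 ^+ 2 - x1 ^+ 3 - a * x1 by rewrite e1; ring.
by apply/eqP; rewrite eb ea; field.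
Qed.

Lemma opp_raw_on_curve a b P : on_curve a b P -> on_curve a b (opp_raw P).
Proof. by case: P => [[x y]|] //=; rewrite sqrrN. Qed.

Section Points.
Variables a b : rat.

Definition zero_pt : point a b := @Point a b None isT.

Definition add_pt (P Q : point a b) : point a b :=
  Point (add_raw_on_curve (pt_on_curve P) (pt_on_curve Q)).

Definition opp_pt (P : point a b) : point a b :=
  Point (opp_raw_on_curve (pt_on_curve P)).

Definition mulz_pt (n : int) (P : point a b) : point a b :=
  match n with
  | Posz m => iter m (add_pt P) zero_pt
  | Negz m => opp_pt (iter m.+1 (add_pt P) zero_pt)
  end.

Definition independent (k : nat) (P : 'I_k -> point a b) : Prop :=
  forall n : 'I_k -> int,
    \big[add_pt/zero_pt]_(i < k) mulz_pt (n i) (P i) = zero_pt ->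
    forall i, n i = 0.

(* The rank of the abelian group E(Q): the maximal number of Z-linearly
   independent points. *)
Definition has_rank (r : nat) : Prop :=
  (exists P : 'I_r -> point a b, independent P) /\
  (forall (k : nat) (P : 'I_k -> point a b), independent P -> (k <= r)%N).

End Points.

Definition legendre (a p : nat) : int :=
  if (p %| a)%N then 0
  else if [exists x : 'I_p, x ^ 2 == a %[mod p]]%N then 1
  else - 1.

Definition perfect_square (n : int) : Prop := exists m : int, n = m ^+ 2.

(* Main.v *)
From HB Require Import structures.
Require Import Defs.
From mathcomp Require Import all_boot all_order all_algebra.
From mathcomp Require Import ring zify.

Import Order.TTheory GRing.Theory Num.Theory.
Local Open Scope ring_scope.
Set Implicit Arguments.
Unset Strict Implicit.
Unset Printing Implicit Defensive.

(** Write N = 2pq, so that the curve is E : y^2 = x^3 - N x.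

    The rank is at least one because every perfect square in the hypotheses
    is a solution in integers of one of the quartics

      D M^4 + C e^4 = n^2     with D C = - N,

    and such a solution is the point of E with x = D M^2 / e^2.  The class of x
    modulo squares is a homomorphism on E([rat]) ([alphaD]); if the classes of
    D and - N D are nontrivial, no multiple of the point can vanish, since E
    has a single point of order two and its class is - N ([nontorsion]).

    The rank is at most one by descent along the 2-isogeny between E and
    y^2 = x^3 + 4 N x.  Every rational point of y^2 = x^3 + b x has
    x = d (M / e)^2 with d c = b and d M^4 + c e^4 = n^2 under coprimality
    conditions ([torsor_of_point]), and such a quartic is obstructed modulo 8,
    modulo 4, by signs, or by the quadratic character of -1, 2 or -2 modulo p
    and q.  On the isogenous curve only the classes 1 and N survive
    ([dual_selmer]); on E only the classes generated by - N and D survive.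
    The quadratic characters needed come from the perfect square itself, so no
    reciprocity law relating p and q enters: for instance p - 2q = m^2 makes p
    a square modulo q, which rules out the quartic - q M^4 + 2 p e^4 = n^2, as
    that one would make 2p, hence 2, a square modulo q.

    A point of E whose class is trivial is twice a point ([halving]) once the
    isogenous curve has no unexpected class.  So every P is 2 P' up to the
    point of order two and the known point R.  Doubling raises the height to
    the fourth power and translation only squares it, both up to a constant;
    hence iterating P -> P' stays in a finite set and two iterates coincide up
    to sign.  This is a relation n P = m R with n <> 0
    ([relation_to_generator]), so any two points are dependent.

    The argument needs E([rat]) to be an abelian group.  Associativity of the
    chord-and-tangent law is a rational identity in generic position
    ([slopes_assoc]); degenerate positions follow from the cancellation law
    - P + (P + Q) = Q ([add_ptKl]) and from one more identity, for
    2 P + 2 P = P + (P + 2 P). *)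

(** * The group law *)

HB.instance Definition _ (a b : rat) := [isSub for @pt_val a b].
HB.instance Definition _ (a b : rat) := [Choice of point a b by <:].

(** Smoothness at the rational points: a singular point lies over a double root of the cubic. *)
Definition nonsingular (a b : rat) : Prop :=
  forall x : rat, x ^+ 3 + a * x + b = 0 -> 3 * x ^+ 2 + a != 0.

(** Here a is eliminated through the slope t of the tangent at (x, y), which makes
    2 P + 2 P = P + (P + 2 P) an identity of rational functions in x, y and t. *)
Lemma double_slopes_assoc (x y t : rat) :
  let a := 2 * y * t - 3 * x ^+ 2 in
  let x2 := t ^+ 2 - x - x in let y2 := t * (x - x2) - y in
  let u := (3 * x2 ^+ 2 + a) / (2 * y2) in
  let w := (y2 - y) / (x2 - x) in
  let x3 := w ^+ 2 - x - x2 in let y3 := w * (x - x3) - y in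
  let v := (y3 - y) / (x3 - x) in
  y2 != 0 -> x2 != x -> x3 != x ->
  u ^+ 2 - x2 - x2 = v ^+ 2 - x - x3 /\
  u * (x2 - (u ^+ 2 - x2 - x2)) - y2 = v * (x - (v ^+ 2 - x - x3)) - y.
Proof.
move=> a x2 y2 u w x3 y3 v n1 n2 n3.
have {}n2 : x2 - x != 0 by rewrite subr_eq0.
have {}n3 : (y2 - y) ^+ 2 - (x + x + x2) * (x2 - x) ^+ 2 != 0.
  apply: contra n3 => /eqP e; rewrite -subr_eq0; apply/eqP.
  have -> : x3 - x = ((y2 - y) ^+ 2 - (x + x + x2) * (x2 - x) ^+ 2) / (x2 - x) ^+ 2.
    by rewrite /x3 /w; field.
  by rewrite e mul0r.
rewrite /u /v /y3 /x3 /w /a.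
rewrite /y2 /x2 in n1 n2 n3 *.
split; field; rewrite n1 n2 /= andbT; apply: contra n3 => /eqP n3;
  by rewrite -[X in _ == X]n3; apply/eqP; ring.
Qed.

(** For P1 = (x1, y1), P2 = (x2, y2), P3 = (x3, y3), let s and t be the slopes of the
    lines P1 P2 and P2 P3.  The five quantities x1, x2, x3, s, t are free parameters:
    the hypothesis, obtained by subtracting the curve equations along the two lines,
    determines y2 as soon as s <> t.  Neighbouring points may coincide, the slope being
    then that of the tangent. *)
Lemma slopes_assoc (x1 x2 x3 y2 s t : rat) :
  let y1 := y2 + s * (x1 - x2) in
  let y3 := y2 + t * (x3 - x2) in
  let xD := s^+2 - x1 - x2 in let yD := s * (x1 - xD) - y1 in
  let xE := t^+2 - x2 - x3 in let yE := t * (x2 - xE) - y2 in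
  let u := (y3 - yD) / (x3 - xD) in
  let v := (yE - y1) / (xE - x1) in
  2 * y2 * (s - t) = x1^+2 - x3^+2 + x2*(x1-x3) - s^+2*(x1-x2) + t^+2*(x3-x2) ->
  s != t -> x3 != xD -> xE != x1 ->
  u^+2 - xD - x3 = v^+2 - x1 - xE /\
  u * (xD - (u^+2 - xD - x3)) - yD = v * (x1 - (v^+2 - x1 - xE)) - y1.
Proof.
move=> y1 y3 xD yD xE yE u v ey2 nst n3D nE1.
have n0 : s - t != 0 by rewrite subr_eq0.
have e2 : y2 = (x1^+2 - x3^+2 + x2*(x1-x3) - s^+2*(x1-x2) + t^+2*(x3-x2)) / (2 * (s-t)).
  by rewrite -ey2; field.
have n1 : x3 - xD != 0 by rewrite subr_eq0.
have n2 : xE - x1 != 0 by rewrite subr_eq0.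
rewrite /xD in n1; rewrite /xE in n2.
rewrite /u /v /yD /yE /xD /xE /y1 /y3 e2.
by split; field; rewrite n0 n1 n2.
Qed.

Section GroupLaw.
Variables a b : rat.
Hypothesis ns : nonsingular a b.

Lemma same_abscissa x y1 y2 : y1 ^+ 2 = x ^+ 3 + a * x + b ->
  y2 ^+ 2 = x ^+ 3 + a * x + b -> y1 = y2 \/ y1 = - y2.
Proof.
move=> e1 e2; have /eqP : y1 ^+ 2 = y2 ^+ 2 by rewrite e1 e2.
by rewrite eqf_sqr => /orP[] /eqP; [left|right].
Qed.

(** Chords and tangents obey the same two equations: the second one is the curve
    equation at the first point minus that at the second one, divided by x1 - x2,
    and it keeps its meaning when the points coincide.  This is what lets later
    proofs treat both cases at once. *)
Lemma add_slope x1 y1 x2 y2 :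
  on_curve a b (Some (x1, y1)) -> on_curve a b (Some (x2, y2)) ->
  ~~ ((x1 == x2) && (y1 == - y2)) ->
  exists s, [/\ y1 = y2 + s * (x1 - x2),
    s * (y1 + y2) = x1 ^+ 2 + x1 * x2 + x2 ^+ 2 + a &
    add_raw a (Some (x1, y1)) (Some (x2, y2)) =
      Some (s ^+ 2 - x1 - x2, s * (x1 - (s ^+ 2 - x1 - x2)) - y1)].
Proof.
move=> /eqP e1 /eqP e2 n12; rewrite /= (negPf n12).
have [ex|nx] := eqVneq x1 x2.
  subst x2; move: n12; rewrite eqxx /= => ny.
  have [ey|ey] := same_abscissa e1 e2; last by rewrite ey eqxx in ny.
  subst y2; have y0 : y1 != 0 by apply: contra ny => /eqP ->; rewrite oppr0.
  by exists ((3 * x1 ^+ 2 + a) / (2 * y1)); split => //; field.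
have n0 : x2 - x1 != 0 by rewrite subr_eq0 eq_sym.
exists ((y2 - y1) / (x2 - x1)); split => //; first by field.
have -> : (y2 - y1) / (x2 - x1) * (y1 + y2) = (y2 ^+ 2 - y1 ^+ 2) / (x2 - x1).
  by field.
by rewrite e1 e2; field.
Qed.

Lemma add_chord x1 y1 x2 y2 : x1 != x2 ->
  let s := (y2 - y1) / (x2 - x1) in
  add_raw a (Some (x1, y1)) (Some (x2, y2)) =
      Some (s ^+ 2 - x1 - x2, s * (x1 - (s ^+ 2 - x1 - x2)) - y1).
Proof. by move=> /negPf /= ->. Qed.

Lemma add_tangent x y : y != 0 ->
  let s := (3 * x ^+ 2 + a) / (2 * y) in
  add_raw a (Some (x, y)) (Some (x, y)) =
      Some (s ^+ 2 - x - x, s * (x - (s ^+ 2 - x - x)) - y).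
Proof.
move=> y0 /=; rewrite eqxx /= -addr_eq0 -mulr2n.
by rewrite mulrn_eq0 /= (negPf y0).
Qed.

Lemma add_ptC : commutative (@add_pt a b).
Proof.
move=> [P hP] [Q hQ]; apply: val_inj => /=.
case: P hP => [[x1 y1]|]; case: Q hQ => [[x2 y2]|] // hQ hP.
have [/andP[/eqP ex /eqP ey]|n12] := boolP ((x1 == x2) && (y1 == - y2)).
  by rewrite ex ey /= !eqxx opprK eqxx.
have [s [e1 _ es]] := add_slope hP hQ n12.
have [ex|nx] := eqVneq x1 x2.
  by move: e1; rewrite ex subrr mulr0 addr0 => ->.
rewrite -!/(add_raw a (Some _) (Some _)) es.
have n21 : ~~ ((x2 == x1) && (y2 == - y1)).
  by rewrite eq_sym (negPf nx).
have n0 : x2 - x1 != 0 by rewrite subr_eq0 eq_sym.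
have [s' [e2 _ ->]] := add_slope hQ hP n21.
have ess : s = s'.
  apply: (mulIf n0); have := e1; rewrite e2 => /eqP; rewrite -subr_eq0 => /eqP h.
  apply/eqP; rewrite -subr_eq0; apply/eqP; rewrite -[RHS]h; ring.
rewrite -ess; congr (Some (_, _)); first by ring.
by rewrite e1; ring.
Qed.

Lemma add_0pt : left_id (zero_pt a b) (@add_pt a b).
Proof. by move=> P; apply: val_inj. Qed.

Lemma add_Npt : left_inverse (zero_pt a b) (@opp_pt a b) (@add_pt a b).
Proof.
by move=> [[[x y]|] hP]; apply: val_inj => //=; rewrite !eqxx.
Qed.

Lemma opp_ptK : involutive (@opp_pt a b).
Proof. by move=> [[[x y]|] hP]; apply: val_inj => //=; rewrite opprK. Qed.

Lemma opp_ptD (P Q : point a b) :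
  opp_pt (add_pt P Q) = add_pt (opp_pt P) (opp_pt Q).
Proof.
apply: val_inj; case: P => [[[x1 y1]|] hP]; case: Q => [[[x2 y2]|] hQ] //=.
rewrite eqr_opp; case: ifP => // _ /=; case: ifP => _ /=; congr (Some (_, _)).
- by rewrite mulrN invrN mulrN sqrrN.
- by rewrite mulrN invrN mulrN sqrrN; ring.
- by rewrite -opprD mulNr sqrrN.
by rewrite -opprD mulNr sqrrN; ring.
Qed.

(** The chord from - P to P + Q is the reflected chord from P to Q, so it has slope
    - s and meets the curve again in Q.  The only obstruction is P + Q = P with P
    of order two, which would make x1 a double root of the cubic. *)
Lemma add_ptKl (P Q : point a b) : add_pt (opp_pt P) (add_pt P Q) = Q.
Proof.
apply: val_inj; case: P => [[[x1 y1]|] hP]; case: Q => [[[x2 y2]|] hQ] //;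
  last by rewrite /= !eqxx.
change (add_raw a (Some (x1, - y1)) (add_raw a (Some (x1, y1)) (Some (x2, y2)))
  = Some (x2, y2)).
have [/andP[/eqP ex /eqP ey]|n12] := boolP ((x1 == x2) && (y1 == - y2)).
  by rewrite ex ey /= !eqxx /= opprK.
have [s [e1 es es']] := add_slope hP hQ n12.
have hD := add_raw_on_curve hP hQ; rewrite es' in hD *.
set x3 := s ^+ 2 - x1 - x2 in hD *; set y3 := s * _ - y1 in hD *.
have hP' : on_curve a b (Some (x1, - y1)) by exact: (opp_raw_on_curve hP).
have n13 : ~~ ((x1 == x3) && (- y1 == - y3)).
  apply/negP => /andP[/eqP ex /eqP/oppr_inj ey].
  have y0 : y1 = 0.
    have : y1 = - y1 by rewrite {1}ey /y3 -/x3 -ex subrr mulr0 sub0r.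
    by move/eqP; rewrite -addr_eq0 -mulr2n mulrn_eq0 /= => /eqP.
  have /eqP e0 := hP; have := @ns x1; rewrite -e0 y0 expr0n /= => /(_ erefl).
  move/negP; apply; apply/eqP.
  have e2 : s ^+ 2 = x1 + x1 + x2 by rewrite {1}ex /x3; ring.
  have ey2 : y2 = - s * (x1 - x2).
    by apply/eqP; rewrite -subr_eq0; apply/eqP; rewrite -[RHS]y0 e1; ring.
  move: es; rewrite y0 add0r ey2.
  have -> : s * (- s * (x1 - x2)) = - s ^+ 2 * (x1 - x2) by ring.
  rewrite e2 => /eqP; rewrite -subr_eq0 => /eqP h.
  by apply/eqP; rewrite -oppr_eq0 -[X in _ == X]h; apply/eqP; ring.
have [r [f1 fr fr']] := add_slope hP' hD n13.
have er : r = - s.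
  have [ex|nx] := eqVneq x1 x3.
    have ey3 : y3 = - y1 by rewrite /y3 -/x3 -ex subrr mulr0 sub0r.
    have y0 : y1 != 0.
      by apply: contra n13 => /eqP y0; rewrite -ex eqxx ey3 y0 !oppr0 eqxx.
    have n2 : 2 * y1 != 0 by rewrite mulf_neq0.
    apply: (mulIf n2); apply/eqP; rewrite -subr_eq0; apply/eqP.
    have e2 : s ^+ 2 = x1 + x1 + x2 by rewrite {1}ex /x3; ring.
    move: fr; rewrite -ex ey3 => fr.
    have ey2 : y2 = y1 - s * (x1 - x2) by rewrite e1; ring.
    have {}es : 2 * s * y1 = x1 ^+ 2 + x1 * x2 + x2 ^+ 2 + a + s ^+ 2 * (x1 - x2).
      by rewrite -es ey2; ring.
    have -> : r * (2 * y1) - - s * (2 * y1) =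
              - (r * (- y1 + - y1)) + 2 * s * y1 by ring.
    by rewrite fr es e2; ring.
  have n0 : x1 - x3 != 0 by rewrite subr_eq0.
  apply: (mulIf n0); apply/eqP; rewrite -subr_eq0; apply/eqP.
  have : y3 + r * (x1 - x3) - (- y1) = 0 by rewrite -f1 subrr.
  by rewrite /y3 -/x3 => <-; ring.
rewrite fr' er /= sqrrN; congr (Some (_, _)); first by rewrite /x3; ring.
by rewrite e1 /x3; ring.
Qed.

Lemma add_ptNKl (P Q : point a b) : add_pt P (add_pt (opp_pt P) Q) = Q.
Proof. by rewrite -{1}[P]opp_ptK add_ptKl. Qed.

Lemma add_pt_inj (P Q Q' : point a b) : add_pt P Q = add_pt P Q' -> Q = Q'.
Proof. by move=> e; rewrite -[Q](add_ptKl P) e add_ptKl. Qed.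

Lemma add_pt0 (P : point a b) : add_pt P (zero_pt a b) = P.
Proof. by rewrite add_ptC add_0pt. Qed.

Lemma abscissa_eq (P Q : point a b) x y1 y2 :
  pt_val P = Some (x, y1) -> pt_val Q = Some (x, y2) -> P = Q \/ P = opp_pt Q.
Proof.
case: P => P hP; case: Q => Q hQ /= eP eQ; subst P Q.
have /eqP e1 := hP; have /eqP e2 := hQ.
by have [e|e] := same_abscissa e1 e2; [left|right]; apply: val_inj; rewrite /= e.
Qed.

Lemma abscissa_neq (P Q : point a b) x1 y1 x2 y2 :
  pt_val P = Some (x1, y1) -> pt_val Q = Some (x2, y2) ->
  P != Q -> P != opp_pt Q -> x1 != x2.
Proof.
move=> eP eQ n1 n2; apply/eqP => ex; rewrite -ex in eQ.
by case: (abscissa_eq eP eQ) => e; rewrite e eqxx in n1 n2.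
Qed.

Lemma nopp_pt (P Q : point a b) x1 y1 x2 y2 :
  pt_val P = Some (x1, y1) -> pt_val Q = Some (x2, y2) ->
  P != opp_pt Q -> ~~ ((x1 == x2) && (y1 == - y2)).
Proof.
move=> eP eQ; apply: contra => /andP[/eqP ex /eqP ey].
by apply/eqP/val_inj; rewrite /= eP eQ ex ey.
Qed.

(** None of the four additions degenerates, and the two outer ones are chords.  If
    the slopes s and t were equal, the three points would lie on one line and
    A + B would be - C. *)
Lemma add_ptA_generic (A B C : point a b) :
  A != opp_pt B -> C != opp_pt B -> A != C ->
  add_pt A B != C -> add_pt A B != opp_pt C ->
  A != add_pt B C -> A != opp_pt (add_pt B C) ->
  add_pt (add_pt A B) C = add_pt A (add_pt B C).
Proof.
case eA: (pt_val A) => [[x1 y1]|]; last first.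
  by have -> : A = zero_pt a b by [apply: val_inj]; rewrite !add_0pt.
case eB: (pt_val B) => [[x2 y2]|]; last first.
  by have -> : B = zero_pt a b by [apply: val_inj]; rewrite add_pt0 add_0pt.
case eC: (pt_val C) => [[x3 y3]|]; last first.
  by have -> : C = zero_pt a b by [apply: val_inj]; rewrite !add_pt0.
move=> nAB nCB nAC nD nD' nE nE'.
have hA := pt_on_curve A; have hB := pt_on_curve B; have hC := pt_on_curve C.
rewrite eA in hA; rewrite eB in hB; rewrite eC in hC.
have [s [e1 es eD]] := add_slope hA hB (nopp_pt eA eB nAB).
have [t [e3 et eE]] := add_slope hC hB (nopp_pt eC eB nCB).
have vD : pt_val (add_pt A B) = add_raw a (Some (x1, y1)) (Some (x2, y2)).
  by rewrite /= eA eB.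
have vE : pt_val (add_pt B C) = add_raw a (Some (x3, y3)) (Some (x2, y2)).
  by rewrite add_ptC /= eC eB.
rewrite eD in vD; rewrite eE in vE.
have n3D : x3 != s ^+ 2 - x1 - x2 by rewrite eq_sym (abscissa_neq vD eC).
have nE1 : t ^+ 2 - x3 - x2 != x1 by rewrite eq_sym (abscissa_neq eA vE).
have nst : s != t.
  apply: contra n3D => /eqP est; subst t.
  have n13 : x1 != x3.
    apply: contra nAC => /eqP ex; subst x3.
    by apply/eqP/val_inj; rewrite /= eA eC e1 e3.
  have n0 : x1 - x3 != 0 by rewrite subr_eq0.
  apply/eqP/(mulfI n0)/eqP; rewrite -subr_eq0; apply/eqP.
  have : (x1 ^+ 2 + x1 * x2 + x2 ^+ 2 + a) - (x3 ^+ 2 + x3 * x2 + x2 ^+ 2 + a)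
     - s * (y1 - y3) = 0 by rewrite -es -et; ring.
  by rewrite e1 e3 => h; rewrite -[RHS]h; ring.
have ey2 : 2 * y2 * (s - t) = x1 ^+ 2 - x3 ^+ 2 + x2 * (x1 - x3)
    - s ^+ 2 * (x1 - x2) + t ^+ 2 * (x3 - x2).
  have : (x1 ^+ 2 + x1 * x2 + x2 ^+ 2 + a) - (x3 ^+ 2 + x3 * x2 + x2 ^+ 2 + a)
     - s * (y1 + y2) + t * (y3 + y2) = 0 by rewrite -es -et; ring.
  by rewrite e1 e3 => h; apply/eqP; rewrite -subr_eq0 -[X in _ == X]oppr0 -h;
     apply/eqP; ring.
have exE : t ^+ 2 - x2 - x3 = t ^+ 2 - x3 - x2 by ring.
rewrite -exE in nE1 vE.
have [] := slopes_assoc ey2 nst n3D nE1.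
have eyE : t * (x3 - (t ^+ 2 - x2 - x3)) - y3 = t * (x2 - (t ^+ 2 - x2 - x3)) - y2.
  by rewrite e3; ring.
rewrite eyE in vE; rewrite -e1 -e3 => f1 f2.
apply: val_inj; rewrite [LHS]/= -/(add_raw _ _ _).
change (add_raw a (pt_val (add_pt A B)) (pt_val C)
  = add_raw a (pt_val A) (pt_val (add_pt B C))).
rewrite vD vE eC eA add_chord 1?eq_sym // add_chord 1?eq_sym //.
congr (Some (_, _)); [exact: f1|exact: f2].
Qed.

Lemma add_ptA_double_double (D : point a b) :
  add_pt D D != zero_pt a b -> 
  add_pt D D != D -> add_pt D D != opp_pt D -> 
  add_pt D D != opp_pt (add_pt D D) ->
  add_pt D (add_pt D D) != D -> add_pt D (add_pt D D) != opp_pt D ->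
  add_pt (add_pt D D) (add_pt D D) = add_pt D (add_pt D (add_pt D D)).
Proof.
case eD: (pt_val D) => [[x y]|]; last first.
  by have -> : D = zero_pt a b by [apply: val_inj]; rewrite !add_0pt.
move=> n0 n1 n2 n3 n4 n5.
have hD := pt_on_curve D; rewrite eD in hD.
have y0 : y != 0.
  apply: contra n0 => /eqP y0; apply/eqP/val_inj.
  by rewrite /= eD /= y0 oppr0 !eqxx.
set t := (3 * x ^+ 2 + a) / (2 * y).
have ea : a = 2 * y * t - 3 * x ^+ 2 by rewrite /t; field.
have v2 : pt_val (add_pt D D) = add_raw a (Some (x, y)) (Some (x, y)).
  by rewrite /= eD.
rewrite add_tangent // -/t in v2.
set x2 := t ^+ 2 - x - x in v2; set y2 := t * (x - x2) - y in v2.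
have y2n : y2 != 0.
  apply: contra n3 => /eqP e; apply/eqP/val_inj.
  change (pt_val (add_pt D D) = opp_raw (pt_val (add_pt D D))).
  by rewrite v2 /= e oppr0.
have nx2 : x2 != x by exact: (abscissa_neq v2 eD).
have v3 : pt_val (add_pt D (add_pt D D)) = add_raw a (Some (x, y)) (Some (x2, y2)).
  by rewrite -v2 -eD.
rewrite add_chord 1?eq_sym // in v3.
have nx3 := abscissa_neq v3 eD n4 n5.
have := @double_slopes_assoc x y t; rewrite -ea -/x2 -/y2 => -[] // f1 f2.
apply: val_inj.
change (add_raw a (pt_val (add_pt D D)) (pt_val (add_pt D D))
  = add_raw a (pt_val D) (pt_val (add_pt D (add_pt D D)))).
rewrite v2 v3 eD add_tangent // add_chord 1?eq_sym //.
congr (Some (_, _)); [exact: f1|exact: f2].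
Qed.

(** Singled out because the remaining coincidences A + B = C and A = B + C of
    [add_ptA] reduce to it by cancellation, without computing a tangent at a sum. *)
Lemma add_ptA_double (D E : point a b) :
  add_pt (add_pt D D) E = add_pt D (add_pt D E).
Proof.
have [->|nE] := eqVneq E D; first by rewrite add_ptC.
have [->|nE'] := eqVneq E (opp_pt D).
  by rewrite add_ptC add_ptKl [add_pt D (opp_pt D)]add_ptC add_Npt add_pt0.
have [eD|nD] := eqVneq D (opp_pt D).
  by rewrite {1 3}eD add_Npt add_0pt add_ptKl.
have [e|n2] := eqVneq (add_pt D D) (opp_pt E).
  have -> : E = opp_pt (add_pt D D) by rewrite e opp_ptK.
  by rewrite add_ptC add_Npt opp_ptD add_ptNKl add_ptC add_Npt.
have [->|E0] := eqVneq E (zero_pt a b); first by rewrite !add_pt0.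
have n3 : D != add_pt D E.
  by apply: contra E0 => /eqP e; apply/eqP/(@add_pt_inj D); rewrite add_pt0 -e.
have n4 : D != opp_pt (add_pt D E).
  apply: contra n2 => /eqP e; apply/eqP.
  have f : add_pt D E = opp_pt D by rewrite [in RHS]e opp_ptK.
  suff -> : E = opp_pt (add_pt D D) by rewrite opp_ptK.
  by rewrite opp_ptD -[LHS](add_ptKl D) f.
have [e|n5] := eqVneq (add_pt D D) E.
  subst E; apply: add_ptA_double_double => //; first by rewrite eq_sym.
  by rewrite -(inj_eq (can_inj opp_ptK)) opp_ptK eq_sym.
by apply: add_ptA_generic => //; rewrite eq_sym.
Qed.

Lemma add_ptA : associative (@add_pt a b).
Proof.
move=> A B C; apply/esym.
have [->|nAB] := eqVneq A (opp_pt B).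
  by rewrite add_ptKl add_Npt add_0pt.
have [->|nCB] := eqVneq C (opp_pt B).
  by rewrite [add_pt B _]add_ptC add_Npt add_pt0 add_ptC [add_pt A B]add_ptC add_ptKl.
have [->|nAC] := eqVneq A C; first by rewrite add_ptC [add_pt B C]add_ptC.
have [e|nD] := eqVneq (add_pt A B) (opp_pt C).
  rewrite e add_Npt; have -> : C = opp_pt (add_pt A B) by rewrite e opp_ptK.
  rewrite [add_pt A B]add_ptC opp_ptD add_ptNKl.
  by rewrite add_ptC add_Npt.
have [e|nE] := eqVneq A (opp_pt (add_pt B C)).
  rewrite [in RHS]e add_Npt; have -> : C = opp_pt (add_pt B A).
    by rewrite e opp_ptD opp_ptK add_ptKl.
  by rewrite [add_pt A B]add_ptC add_ptC add_Npt.
have [e|nD'] := eqVneq (add_pt A B) C.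
  have eB : B = add_pt (opp_pt A) C by rewrite -e add_ptKl.
  have -> : add_pt B C = add_pt (opp_pt A) (add_pt C C).
    by rewrite eB [RHS]add_ptC add_ptA_double add_ptC [add_pt C (opp_pt A)]add_ptC.
  by rewrite e add_ptNKl.
have [e|nE'] := eqVneq A (add_pt B C).
  have eB : B = add_pt (opp_pt C) A by rewrite e [add_pt B C]add_ptC add_ptKl.
  have -> : add_pt A B = add_pt (opp_pt C) (add_pt A A).
    by rewrite eB [RHS]add_ptC add_ptA_double [add_pt A (opp_pt C)]add_ptC.
  by rewrite -e add_ptC add_ptNKl.
exact: add_ptA_generic.
Qed.
End GroupLaw.

(** * Heights of rational numbers *)

Definition height (x : rat) : nat := maxn `|numq x|%N `|denq x|%N.

Lemma height_gt0 x : (0 < height x)%N.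
Proof. by rewrite /height leq_max !absz_gt0 denq_neq0 orbT. Qed.

Lemma numden_clear (x : rat) :
  exists r s : int, [/\ x = r%:~R / s%:~R, s != 0, coprimez r s,
    r = numq x & s = denq x].
Proof.
exists (numq x), (denq x); rewrite divq_num_den denq_neq0; split => //.
exact: coprime_num_den.
Qed.

(** The rational root theorem: the denominator divides A, and the numerator divides C,
    or divides B when C = 0, the other root being 0. *)
Lemma height_quadratic (A B C : int) (x : rat) : A != 0 ->
  A%:~R * x ^+ 2 + B%:~R * x + C%:~R = 0 ->
  (height x <= `|A| + `|B| + `|C|)%N.
Proof.
move=> A0; have [r [s [ex s0 co er es]]] := numden_clear x => e.
have s0' : s%:~R != 0 :> rat by rewrite intr_eq0.
have {e} e : A * r ^+ 2 + B * r * s + C * s ^+ 2 = 0.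
  apply/eqP; rewrite -(intr_eq0 rat) !(rmorphD, rmorphM, rmorphXn) /=.
  rewrite -(mulr0 (s%:~R ^+ 2)) -e ex; apply/eqP; by field.
have dvd_le (d m : int) : m != 0 -> (d %| m)%Z -> (`|d| <= `|m|)%N.
  by move=> m0 dm; apply: dvdn_leq; rewrite ?absz_gt0.
rewrite /height -er -es geq_max; apply/andP; split; last first.
  suff /(dvd_le _ _ A0) h : (s %| A)%Z by lia.
  have : (s %| A * r ^+ 2)%Z.
    by apply/dvdzP; exists (- (B * r + C * s)); apply: subr0_eq; rewrite -[RHS]e; ring.
  by rewrite Gauss_dvdzl // coprimezXr // coprimez_sym.
have [->//|r0] := eqVneq r 0.
have [C0|C0] := eqVneq C 0.
  have e' : A * r = - (B * s).
    by apply/(mulfI r0)/eqP; rewrite -subr_eq0 -[X in _ == X]e C0; apply/eqP; ring.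
  have B0 : B != 0.
    by apply: contra (mulf_neq0 A0 r0) => /eqP B0; rewrite e' B0 mul0r oppr0.
  suff /(dvd_le _ _ B0) h : (r %| B)%Z by lia.
  have : (r %| B * s)%Z by apply/dvdzP; exists (- A); rewrite mulNr e' opprK.
  by rewrite Gauss_dvdzl.
suff /(dvd_le _ _ C0) h : (r %| C)%Z by lia.
have : (r %| C * s ^+ 2)%Z.
  by apply/dvdzP; exists (- (A * r + B * s)); apply: subr0_eq; rewrite -[RHS]e; ring.
by rewrite Gauss_dvdzl // coprimezXr.
Qed.

Lemma absz_addr_le (x y : int) : (absz (x + y)%R <= `|x| + `|y|)%N.
Proof. lia. Qed.

Lemma absz_lincomb_le (h : nat) (r s c d : int) :
  (`|r| <= h)%N -> (`|s| <= h)%N ->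
  (absz (r * c + s * d)%R <= h * (`|c| + `|d|))%N.
Proof.
move=> hr hs; apply: leq_trans (absz_addr_le _ _) _.
by rewrite !abszM mulnDr leq_add // leq_mul.
Qed.

Lemma quadratic_sum_le (h w N X Y Z W : nat) :
  (X <= h * w)%N -> (Y <= h * w)%N ->
  (Z <= h * ((N + 1) * w))%N -> (W <= h * ((N + 1) * w))%N ->
  (X ^ 2 + 2 * Y * Z + W ^ 2 <= ((N + 2) * w) ^ 2 * h ^ 2)%N.
Proof.
move=> hX hY hZ hW; rewrite -expnMn.
have -> : ((N + 2) * w * h = h * w + h * ((N + 1) * w))%N by ring.
rewrite sqrnD addnAC; apply: leq_add; first by rewrite leq_add ?leq_sqr.
by rewrite -mulnA leq_mul2l leq_mul.
Qed.

(** The quadratic is satisfied by the abscissas of P + Q and P - Q, where x1 and x2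
    are those of P and Q: its coefficients are symmetric, hence free of the ordinates.
    Homogeneity of degree two in the numerator and denominator of x1 gives the exponent. *)
Lemma height_translate (N : nat) (x1 x2 x3 : rat) : x1 != x2 ->
  (x1 - x2) ^+ 2 * x3 ^+ 2 - 2 * (x1 + x2) * (x1 * x2 - N%:R) * x3
    + (x1 * x2 + N%:R) ^+ 2 = 0 ->
  (height x3 <= ((N + 2) * (`|numq x2| + `|denq x2|)) ^ 2 * height x1 ^ 2)%N.
Proof.
move=> n12.
have [r [s [ex s0 co er es]]] := numden_clear x1.
have [u [v [ey v0 co' eu ev]]] := numden_clear x2 => e.
have s0' : s%:~R != 0 :> rat by rewrite intr_eq0.
have v0' : v%:~R != 0 :> rat by rewrite intr_eq0.
set A := (r * v - u * s) ^+ 2.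
set B := - (2 * (r * v + u * s) * (r * u - N%:Z * s * v)).
set C := (r * u + N%:Z * s * v) ^+ 2.
have A0 : A != 0.
  rewrite expf_neq0 //; apply: contra n12 => /eqP h.
  rewrite ex ey -subr_eq0; apply/eqP.
  have -> : r%:~R / s%:~R - u%:~R / v%:~R = (r * v - u * s)%:~R / (s * v)%:~R :> rat.
    by rewrite !(rmorphD, rmorphB, rmorphM, rmorphN) /=; field; rewrite ?s0' ?v0'.
  by rewrite h mul0r.
have hq : A%:~R * x3 ^+ 2 + B%:~R * x3 + C%:~R = 0.
  rewrite -(mulr0 ((s%:~R * v%:~R) ^+ 2)) -e ex ey /A /B /C.
  by rewrite !(rmorphD, rmorphB, rmorphM, rmorphN, rmorphXn) /=; field; rewrite ?s0' ?v0'.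
apply: leq_trans (height_quadratic A0 hq) _; rewrite -eu -ev.
set h := height x1; have hr : (`|r| <= h)%N by rewrite er leq_maxl.
have hs : (`|s| <= h)%N by rewrite es leq_maxr.
set w := (`|u| + `|v|)%N.
have lin (c d : int) := absz_lincomb_le c d hr hs.
have b1 : (absz (r * v - u * s)%R <= h * w)%N.
  by have := lin v (- u); rewrite abszN [X in (_ <= h * X)%N]addnC mulrN [s * u]mulrC.
have b1' : (absz (r * v + u * s)%R <= h * w)%N.
  by have := lin v u; rewrite [X in (_ <= h * X)%N]addnC [s * u]mulrC.
have wN : (`|u| + N * `|v| <= (N + 1) * w)%N.
  by rewrite /w mulnDl mul1n mulnDr addnC leq_add ?leq_addl ?leq_addr.
have b2 : (absz (r * u + N%:Z * s * v)%R <= h * ((N + 1) * w))%N.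
  have := lin u (N%:Z * v); rewrite abszM absz_nat mulrCA mulrA => /leq_trans-> //.
  by rewrite leq_mul.
have b2' : (absz (r * u - N%:Z * s * v)%R <= h * ((N + 1) * w))%N.
  have := lin u (- (N%:Z * v)); rewrite abszN abszM absz_nat mulrN mulrCA mulrA.
  by move=> /leq_trans-> //; rewrite leq_mul.
rewrite /A /B /C abszN !abszX !abszM absz_nat.
exact: quadratic_sum_le.
Qed.

(** The equation says that z is the abscissa of the double of a point with abscissa x.
    With x = r / s, z is the quotient of the quartic forms f and g below.  They have
    resultant a multiple of N^3, witnessed by two Bezout identities, so that little
    cancels in f / g; and f is at least max(|r|, |s|)^4 because N is positive. *)
Lemma height_double (N : nat) (x z : rat) : (0 < N)%N ->
  z * (4 * x * (x ^+ 2 - N%:R)) = (x ^+ 2 + N%:R) ^+ 2 ->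
  (height x ^ 4 <= 16 * N ^ 3 * height z)%N.
Proof.
move=> N0.
have [r [s [ex s0 co er es]]] := numden_clear x.
have [m [n [ez n0 co' em en]]] := numden_clear z => e.
have s0' : s%:~R != 0 :> rat by rewrite intr_eq0.
have n0' : n%:~R != 0 :> rat by rewrite intr_eq0.
set f := (r ^+ 2 + N%:Z * s ^+ 2) ^+ 2.
set g := 4 * r * s * (r ^+ 2 - N%:Z * s ^+ 2).
have emn : m * g = n * f.
  apply/eqP; rewrite -(eqr_int rat) -subr_eq0; apply/eqP.
  have := congr1 (fun t => t * (n%:~R * s%:~R ^+ 4)) e.
  move/eqP; rewrite -subr_eq0 => /eqP <-.
  rewrite ez ex /f /g !(rmorphD, rmorphB, rmorphM, rmorphN, rmorphXn) /=.
  by field; rewrite s0'.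
have fpos : 0 < r ^+ 2 + N%:Z * s ^+ 2.
  by rewrite ltr_wpDl ?sqr_ge0 // mulr_gt0 ?exprn_even_gt0.
have f0 : f != 0 by rewrite /f expf_neq0 // gt_eqF.
have [k ek] : exists k, f = k * m.
  apply/dvdzP; have : (m %| f * n)%Z by rewrite mulrC -emn dvdz_mulr.
  by rewrite Gauss_dvdzl.
have m0 : m != 0 by apply: contra f0 => /eqP m0; rewrite ek m0 mulr0.
have eg : g = k * n by apply: (mulfI m0); rewrite emn ek; ring.
have kK : (k %| 16 * N%:Z ^+ 3)%Z.
  (* the common factor k of f and g divides multiples of s^7 and of r^7 *)
  have k1 : (k %| (16 * N%:Z ^+ 3) * s ^+ 7)%Z.
    have -> : 16 * N%:Z ^+ 3 * s ^+ 7 =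
       - ((12 * r ^+ 2 * s - 16 * N%:Z * s ^+ 3) * f +
        (-3 * r ^+ 3 - 5 * N%:Z * r * s ^+ 2) * g) by rewrite /f /g; ring.
    by rewrite ek eg rpredN rpredD // dvdz_mull // dvdz_mulr.
  have k2 : (k %| 16 * r ^+ 7)%Z.
    have -> : 16 * r ^+ 7 = (16 * r ^+ 3 - 12 * N%:Z * r * s ^+ 2) * f +
        (-5 * N%:Z * r ^+ 2 * s - 3 * N%:Z ^+ 2 * s ^+ 3) * g by rewrite /f /g; ring.
    by rewrite ek eg rpredD // dvdz_mull // dvdz_mulr.
  have [[p q] epq] : exists uv : int * int, uv.1 * r ^+ 7 + uv.2 * s ^+ 7 = 1.
    have : coprimez (r ^+ 7) (s ^+ 7) by rewrite coprimezXl // coprimezXr.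
    by move/coprimezP => [uv h]; exists uv; rewrite h.
  have -> : 16 * N%:Z ^+ 3 = p * N%:Z ^+ 3 * (16 * r ^+ 7) + q * (16 * N%:Z ^+ 3 * s ^+ 7).
    by rewrite -[LHS]mulr1 -epq /=; ring.
  by rewrite rpredD // dvdz_mull.
have kle : (`|k| <= 16 * N ^ 3)%N.
  have -> : (16 * N ^ 3)%N = absz (16 * N%:Z ^+ 3)%R by rewrite abszM abszX.
  by apply: dvdn_leq => //; rewrite absz_gt0 mulf_neq0 // expf_neq0 //; lia.
have fle : (`|f| <= 16 * N ^ 3 * height z)%N.
  by rewrite ek abszM leq_mul // em leq_maxl.
apply: leq_trans fle; rewrite /height -er -es /f abszX.
rewrite (_ : 4 = 2 * 2)%N // expnM leq_sqr.
have abs2 (c : int) : c ^+ 2 = (`|c| ^ 2)%N%:Z.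
  by rewrite -abszX abszE ger0_norm ?sqr_ge0.
rewrite !abs2 -PoszM -PoszD absz_nat.
case: (leqP `|r| `|s|) => _; last exact: leq_addr.
by apply: leq_trans (leq_addl _ _); rewrite leq_pmull.
Qed.

(** * Descent in abelian groups *)

Section Descent.
Variables (G : zmodType) (R T : G) (H : G -> nat) (K : nat).
Hypothesis T2 : T *~ 2 = 0.
Hypothesis northcott : forall B, exists (F : finType) (f : G -> F), forall P Q,
  (H P <= B)%N -> (H Q <= B)%N -> f P = f Q -> P = Q \/ P = - Q.
Hypothesis descent : forall P, exists P' (i j : int),
  P = P' *~ 2 + R *~ i + T *~ j /\ (H P' ^ 2 <= K * H P)%N.

(** Halving P repeatedly, without leaving the height bound B: the inequality
    h(P')^2 <= K h(P) sends [0, B] into itself for B >= K.  The sequence is kept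
    doubled, which kills T. *)
Lemma descent_sequence B n P : (K <= B)%N -> (H P <= B)%N ->
  exists s : nat -> G, [/\ s 0%N = P,
    forall i, (i <= n)%N -> (H (s i) <= B)%N &
    forall i, (i < n)%N -> exists c : int, s i *~ 2 = s i.+1 *~ 4 + R *~ c].
Proof.
move=> KB; elim: n P => [|n IH] P PB.
  by exists (fun=> P); split => // -[].
have [P' [i [j [eP hP']]]] := descent P.
have P'B : (H P' <= B)%N.
  by rewrite -leq_sqr (leq_trans hP') // -mulnn leq_mul.
have [s [s0 sB sS]] := IH P' P'B.
exists (fun k => if k is k'.+1 then s k' else P); split => //.
  by move=> [|k] // kn; apply: sB.
move=> [|k] kn; last exact: sS.
exists (i * 2); rewrite s0 eP !mulrzDl -!mulrzA.
by rewrite [j * 2]mulrC [T *~ _]mulrzA T2 mul0rz addr0 -mulrzDr.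
Qed.

(** Two terms of a long enough descent sequence agree up to sign.  Between them the
    recursion multiplies by a power of two different from 1 and -1, hence gives a
    multiple of that term in the subgroup of R, and P inherits it. *)
Lemma relation_to_generator P : exists n m : int, n != 0 /\ P *~ n = R *~ m.
Proof.
pose B := maxn K (H P).
have [F [f fB]] := northcott B.
have [s [s0 sB sS]] := @descent_sequence B #|F| P (leq_maxl _ _) (leq_maxr _ _).
have link i d : (i + d <= #|F|)%N ->
    exists c : int, s i *~ 2 = s (i + d)%N *~ (2 * 2 ^+ d) + R *~ c.
  elim: d => [|d IH] le_id; first by exists 0; rewrite addn0 addr0.
  have [|c ->] := IH; first by apply: leq_trans le_id; rewrite addnS.
  have [|c' e] := sS (i + d)%N; first by rewrite -addnS.
  exists (c' * 2 ^+ d + c).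
  by rewrite mulrzA e mulrzDl -!mulrzA addnS exprS mulrA -addrA -mulrzDr.
have [i [d [d0 le_id eqf]]] : exists i d,
    [/\ (0 < d)%N, (i + d <= #|F|)%N & f (s i) = f (s (i + d)%N)].
  have /injectivePn [x [y nxy exy]] : ~~ injectiveb (fun k : 'I_#|F|.+1 => f (s k)).
    by apply/injectiveP => /leq_card; rewrite card_ord ltnn.
  wlog lt_xy : x y nxy exy / (x < y)%N.
    move=> wl; have := nxy; rewrite -val_eqE neq_ltn => /orP[|] h; first exact: (wl x y).
    by apply: (wl y x) => //; rewrite eq_sym.
  exists x, (y - x)%N; rewrite subn_gt0 subnKC; last exact: ltnW.
  by split => //; rewrite -ltnS.
have le_i : (i <= #|F|)%N := leq_trans (leq_addr _ _) le_id.
have [c e0] := link 0%N i le_i.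
have [c' ei] := link i d le_id.
have [e [e1 es]] : exists e : int, `|e| = 1 /\ s (i + d)%N = s i *~ e.
  have [e|e] := fB _ _ (sB _ le_i) (sB _ le_id) eqf; first by exists 1; rewrite e.
  by exists (-1); rewrite e mulrN1z opprK.
(* s (i + d) is e times s i, whence u times s i is a multiple of R *)
pose u := 2 - e * (2 * 2 ^+ d).
have eu : s i *~ u = R *~ c'.
  by rewrite mulrzBr ei [s i *~ (e * _)]mulrzA -es addrAC subrr add0r.
exists (2 * u), (c' * (2 * 2 ^+ i) + c * u); split.
  rewrite mulf_neq0 // subr_eq0; apply/eqP => h.
  have h2 : `|2 : int| = `|e * (2 * 2 ^+ d)| by rewrite -h.
  rewrite normrM e1 mul1r normrM normrX !normr_nat -[LHS]mulr1 in h2.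
  have /eqP := mulfI (isT : (2 : int) != 0) h2.
  by rewrite lt_eqF // exprn_egt1 // -lt0n.
rewrite -s0 mulrzA e0 add0n mulrzDl [R *~ (_ + _)]mulrzDr -!mulrzA; congr (_ + _).
by rewrite mulrzA mulrzAC eu -mulrzA.
Qed.
End Descent.

(** * Torsion and square classes *)

Definition is_square (u : rat) : Prop := exists w, u = w ^+ 2.

Lemma is_squareM u v : is_square u -> is_square v -> is_square (u * v).
Proof. by move=> [a ->] [b ->]; exists (a * b); rewrite exprMn. Qed.

Lemma is_square_sqr u : is_square (u ^+ 2).
Proof. by exists u. Qed.

Lemma is_square_cancel u v : u != 0 -> is_square u -> is_square (u * v) ->
  is_square v.
Proof.
move=> u0 [a ea] [b eb]; exists (b / a).
by rewrite expr_div_n -eb -ea [u * v]mulrC mulfK.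
Qed.

Section Torsion.
Variables (G : zmodType) (R T : G) (alpha : G -> rat).
Hypothesis alpha_neq0 : forall P, alpha P != 0.
Hypothesis alpha0 : is_square (alpha 0).
Hypothesis alpha_morph : forall P Q, is_square (alpha (P + Q) * (alpha P * alpha Q)).
Hypothesis torsion2 : forall P, P *+ 2 = 0 -> P = 0 \/ P = T.

Lemma alpha_double P : is_square (alpha (P *+ 2)).
Proof.
have := alpha_morph P P; rewrite -mulr2n mulrC; apply: is_square_cancel.
  by rewrite mulf_neq0.
by exists (alpha P); rewrite expr2.
Qed.

(** Take the least n > 0 with n R = 0.  It is even, as otherwise alpha R would be a
    square; then (n/2) R has order two, so it is T, and the parity of n/2 makes alpha T or
    alpha T * alpha R a square. *)
Lemma nontorsion n : ~ is_square (alpha T) -> ~ is_square (alpha R) ->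
  ~ is_square (alpha T * alpha R) -> (0 < n)%N -> R *+ n <> 0.
Proof.
move=> nT nR nTR.
have odd_mul k : odd k -> is_square (alpha (R *+ k) * alpha R).
  move=> ok; rewrite -(odd_double_half k) ok add1n mulrSr -muln2 mulrnA.
  apply: (is_square_cancel (alpha_neq0 _) (alpha_double (R *+ k./2))).
  by rewrite mulrCA; apply: alpha_morph.
elim/ltn_ind: n => n IH n0 e.
have [on|en] := boolP (odd n).
  by apply: nR; apply: is_square_cancel (odd_mul _ on); rewrite e.
have ek : n = (n./2 * 2)%N by rewrite -[LHS]odd_double_half (negPf en) -muln2.
have k0 : (0 < n./2)%N by lia.
have kn : (n./2 < n)%N by lia.
have [|e2|eT] := @torsion2 (R *+ n./2); first by rewrite -mulrnA -ek.
  exact: (IH _ kn k0).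
have [ok|ek'] := boolP (odd n./2).
  by apply: nTR; rewrite -eT; apply: odd_mul.
apply: nT; rewrite -eT -(odd_double_half n./2) (negPf ek') add0n -muln2 mulrnA.
exact: alpha_double.
Qed.
End Torsion.

(** * The Mordell-Weil group and its rank *)

(** The points again, with the proof of nonsingularity as a parameter: the group
    structure is attached to this alias since associativity depends on that proof. *)
Definition mw_group (a b : rat) (ns : nonsingular a b) : Type := point a b.

HB.instance Definition _ a b (ns : nonsingular a b) :=
  Choice.on (mw_group ns).
HB.instance Definition _ a b (ns : nonsingular a b) :=
  GRing.isZmodule.Build (mw_group ns)
    (add_ptA ns) (@add_ptC a b) (@add_0pt a b) (@add_Npt a b).

Section Rank.
Variables (a b : rat) (ns : nonsingular a b).
Implicit Types P : mw_group ns.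

Lemma mulz_ptE (n : int) P : mulz_pt n P = P *~ n.
Proof.
have nat_case (m : nat) : iter m (add_pt P) (zero_pt a b) = P *+ m.
  by elim: m => //= m ->; rewrite mulrS.
case: n => m; first exact: nat_case.
by rewrite NegzE mulrNz -pmulrn -nat_case.
Qed.

Lemma independentE k (P : 'I_k -> mw_group ns) : independent P <->
  (forall n : 'I_k -> int, \sum_(i < k) P i *~ n i = 0 -> forall i, n i = 0).
Proof.
have e n : \big[@add_pt a b/zero_pt a b]_(i < k) mulz_pt (n i) (P i)
   = \sum_(i < k) P i *~ n i by apply: eq_bigr => i _; rewrite mulz_ptE.
by split=> h n; [rewrite -e|rewrite e]; apply: h.
Qed.

Lemma has_rank1 (R : mw_group ns) :
  (forall n, (0 < n)%N -> R *+ n <> 0) ->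
  (forall P, exists n m : int, n != 0 /\ P *~ n = R *~ m) ->
  has_rank a b 1.
Proof.
move=> Rnt rel; split.
  exists (fun=> R); apply/independentE => n; rewrite big_ord1 => e i.
  rewrite (ord1 i); move: (n _) e => {n i}m e.
  apply/eqP; apply/negPn/negP => m0; apply: (Rnt `|m|%N); first by rewrite absz_gt0.
  by case: m e {m0} => m // /eqP; rewrite NegzE mulrNz oppr_eq0 => /eqP.
move=> k P0; pose P : 'I_k -> mw_group ns := P0.
move/(independentE P) => ind; rewrite leqNgt; apply/negP => k1.
pose i0 : 'I_k := Ordinal (ltnW k1); pose i1 : 'I_k := Ordinal k1.
have [u [v [uv euv]]] : exists u v : int, (u != 0 \/ v != 0) /\ P i0 *~ u + P i1 *~ v = 0.
  have [n [m [n0 e]]] := rel (P i0); have [n' [m' [n0' e']]] := rel (P i1).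
  have [m0|m0] := eqVneq m 0.
    exists n, 0; split; first by left.
    by rewrite e m0 mulr0z addr0.
  exists (n * m'), (- (n' * m)); split; first by right; rewrite oppr_eq0 mulf_neq0.
  by rewrite mulrNz mulrzA e mulrzA e' -!mulrzA mulrC subrr.
pose n (i : 'I_k) := if i == i0 then u else if i == i1 then v else 0.
have en : \sum_(i < k) P i *~ n i = 0.
  rewrite (bigD1 i0) //= (bigD1 i1) //= big1 ?addr0.
    by rewrite /n eqxx.
  by move=> i /andP[h0 h1]; rewrite /n (negPf h0) (negPf h1).
have := ind n en i0; have := ind n en i1; rewrite /n eqxx /= => v0 u0.
by case: uv; rewrite ?v0 ?u0 eqxx.
Qed.
End Rank.

(** * Two-descent on y^2 = x^3 - N x *)

Section Curve.
Variable N : nat.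
Hypothesis N_gt0 : (0 < N)%N.
Let a : rat := - N%:R.

Let N0 : N%:R != 0 :> rat.
Proof. by rewrite pnatr_eq0 -lt0n. Qed.

Lemma nonsingularN : nonsingular a 0.
Proof.
move=> x; rewrite addr0 /a => e; apply/eqP => e2.
have /eqP : 2 * x ^+ 3 = 0.
  by apply: subr0_eq; rewrite subr0 -[RHS]subr0 -{1}(mulr0 x) -{1}e2 -e; ring.
rewrite mulf_eq0 /= expf_eq0 /= => /eqP x0.
by move: e2; rewrite x0 expr0n /= mulr0 add0r => /eqP; rewrite oppr_eq0 (negPf N0).
Qed.

Notation E := (mw_group nonsingularN).
Implicit Types P Q : E.

Lemma curveP P x y : pt_val P = Some (x, y) -> y ^+ 2 = x ^+ 3 + a * x.
Proof. by move=> e; have := pt_on_curve P; rewrite e => /eqP ->; rewrite addr0. Qed.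

Lemma origin_on_curve : on_curve a 0 (Some (0, 0)).
Proof. by rewrite /= !expr0n /= mulr0 !addr0. Qed.
Definition origin_pt : E := Point origin_on_curve.

(** The 2-descent map to the rationals modulo squares; at (0, 0) its value - N is
    forced by additivity. *)
Definition alpha P : rat :=
  if pt_val P is Some (x, _) then (if x == 0 then a else x) else 1.

Lemma alpha_neq0 P : alpha P != 0.
Proof.
rewrite /alpha; case: (pt_val P) => [[x y]|] //; case: ifPn => // _.
by rewrite oppr_eq0.
Qed.

Lemma alphaN P : alpha (- P) = alpha P.
Proof. by rewrite /alpha /=; case: (pt_val P) => [[]|]. Qed.

Lemma eq_origin_pt P y : pt_val P = Some (0, y) -> P = origin_pt.
Proof.
move=> e; apply: val_inj; rewrite /= e; congr (Some (_, _)).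
by have /eqP := curveP e; rewrite expr0n mulr0 addr0 sqrf_eq0 => /eqP.
Qed.

Lemma opp_origin_pt : - origin_pt = origin_pt.
Proof. by apply: val_inj; rewrite /= oppr0. Qed.

Lemma add_origin_pt P x y : pt_val P = Some (x, y) -> x != 0 ->
  exists y', pt_val (origin_pt + P) = Some (a / x, y').
Proof.
move=> e x0; have c := curveP e.
have -> : pt_val (origin_pt + P) = add_raw a (Some (0, 0)) (Some (x, y)) by rewrite -e.
rewrite add_chord 1?eq_sym //; eexists; congr (Some (_, _)).
have -> : a / x = y ^+ 2 / x ^+ 2 - x by rewrite c; field.
by field.
Qed.

Lemma alphaD_origin P : is_square (alpha (origin_pt + P) * (alpha origin_pt * alpha P)).
Proof.
have aT : alpha origin_pt = a by rewrite /alpha /=.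
case e: (pt_val P) => [[x y]|]; last first.
  have -> : P = 0 by apply: val_inj.
  by rewrite addr0 {3}/alpha /= mulr1 aT; exists a; rewrite expr2.
have [x0|x0] := eqVneq x 0.
  rewrite x0 in e; rewrite (eq_origin_pt e) -{1}opp_origin_pt addNr {1}/alpha /= mul1r aT.
  by exists a; rewrite expr2.
have [y' e'] := add_origin_pt e x0.
rewrite aT /alpha e e' mulf_eq0 invr_eq0 oppr_eq0 (negPf N0) (negPf x0) /=.
by exists a; field.
Qed.

(** On the line y = s x + c through P, Q and - (P + Q), the product of the three
    abscissas is c^2. *)
Lemma alphaD P Q : is_square (alpha (P + Q) * (alpha P * alpha Q)).
Proof.
have [->|P_T] := eqVneq P origin_pt; first exact: alphaD_origin.
have [->|Q_T] := eqVneq Q origin_pt.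
  by rewrite addrC [alpha P * _]mulrC; apply: alphaD_origin.
have [ePQ|PQ_O] := eqVneq (P + Q) origin_pt.
  have eQ : Q = origin_pt + - P by rewrite -ePQ addrAC subrr add0r.
  have := alphaD_origin (- P); rewrite -eQ alphaN ePQ.
  by congr is_square; ring.
case eP: (pt_val P) => [[x1 y1]|]; last first.
  have -> : P = 0 by apply: val_inj.
  by rewrite add0r {2}/alpha /= mul1r; exists (alpha Q); rewrite expr2.
case eQ: (pt_val Q) => [[x2 y2]|]; last first.
  have -> : Q = 0 by apply: val_inj.
  by rewrite addr0 {3}/alpha /= mulr1; exists (alpha P); rewrite expr2.
have [->|nPQ] := eqVneq P (- Q).
  by rewrite addNr {1}/alpha /= mul1r alphaN; exists (alpha Q); rewrite expr2.
have cP := curveP eP; have cQ := curveP eQ.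
have hP := pt_on_curve P; have hQ := pt_on_curve Q.
rewrite eP in hP; rewrite eQ in hQ.
have [s [e1 es e3]] := add_slope hP hQ (nopp_pt eP eQ nPQ).
have {}e3 : pt_val (P + Q) = Some (s ^+ 2 - x1 - x2, s * (x1 - (s ^+ 2 - x1 - x2)) - y1).
  by rewrite -e3 -eP -eQ.
have nz (S : E) x y : pt_val S = Some (x, y) -> S != origin_pt -> (x == 0) = false.
  by move=> e nS; apply: contraNF nS => /eqP x0; rewrite x0 in e; rewrite (eq_origin_pt e).
rewrite /alpha eP eQ e3 (nz _ _ _ eP) // (nz _ _ _ eQ) // (nz _ _ _ e3) //.
exists (y1 - s * x1).
have ey2 : y2 = y1 - s * (x1 - x2) by rewrite e1; ring.
have f1 : y1 ^+ 2 - (x1 ^+ 3 + a * x1) = 0 by rewrite cP subrr.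
have f2 : s * (y1 + y2) - (x1 ^+ 2 + x1 * x2 + x2 ^+ 2 + a) = 0 by rewrite es subrr.
rewrite ey2 in f2; apply: subr0_eq.
by rewrite -[RHS](mulr0 x1) -[RHS]subr0 -{1}f2 -f1; ring.
Qed.

(** The denominator 4 x (x^2 - N) is 4 y^2. *)
Lemma double_point P x y : pt_val P = Some (x, y) -> y != 0 ->
  exists x2 y2, pt_val (P *+ 2) = Some (x2, y2) /\
    x2 * (4 * x * (x ^+ 2 - N%:R)) = (x ^+ 2 + N%:R) ^+ 2.
Proof.
move=> e y0; have c := curveP e.
have -> : pt_val (P *+ 2) = add_raw a (Some (x, y)) (Some (x, y)).
  by rewrite mulr2n -e.
rewrite add_tangent //; do 2 eexists; split; first reflexivity.
have -> : 4 * x * (x ^+ 2 - N%:R) = 4 * y ^+ 2 by rewrite c /a; ring.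
apply: (@etrans _ _ ((3 * x ^+ 2 + a) ^+ 2 - 8 * x * y ^+ 2)); first by field.
by rewrite c /a; ring.
Qed.

Hypothesis N_nonsquare : forall x : rat, x ^+ 2 != N%:R.

Lemma torsion2 P : P *+ 2 = 0 -> P = 0 \/ P = origin_pt.
Proof.
case e: (pt_val P) => [[x y]|]; last by left; apply: val_inj.
move=> e2; right; have [y0|y0] := eqVneq y 0; last first.
  by have [x2 [y2 []]] := double_point e y0; rewrite e2.
have := curveP e; rewrite y0 => /esym/eqP.
have -> : x ^+ 3 + a * x = x * (x ^+ 2 - N%:R) by rewrite /a; ring.
rewrite expr0n mulf_eq0 subr_eq0 (negPf (N_nonsquare x)) orbF => /eqP x0.
by rewrite x0 in e; exact: eq_origin_pt e.
Qed.

(** With x = w^2 and z = y / w, the two numbers 2 (w^2 + z) and 2 (w^2 - z) are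
    abscissas on the isogenous curve with product 4 N.  By hypothesis each is a square or N
    times a square, so one of them is a square t^2; changing the signs of w and z
    if needed, it is the first.  Then P is twice the point with abscissa
    (t^2 + 2 w t) / 2 and ordinate t times that. *)
Lemma halving P :
  (forall x y : rat, x != 0 -> y ^+ 2 = x ^+ 3 + 4 * N%:R * x ->
    is_square x \/ is_square (N%:R * x)) ->
  is_square (alpha P) -> exists P', P = P' *+ 2.
Proof.
move=> H1; case eP: (pt_val P) => [[x y]|]; last first.
  by move=> _; exists 0; rewrite mul0rn; apply: val_inj.
have cP := curveP eP; rewrite /alpha eP; case: ifPn => [_ [w ew]|x0].
  have : 0 <= a by rewrite ew sqr_ge0.
  by rewrite oppr_ge0 lern0 => /eqP N_0; move: N_gt0; rewrite N_0.
move=> [w ew].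
have w0 : w != 0 by apply: contra x0 => /eqP w0; rewrite ew w0 expr0n.
have [z [t [v [ev ey et ex]]]] : exists z t v, [/\ v ^+ 2 = x, y = v * z,
    z ^+ 2 = v ^+ 4 - N%:R & t ^+ 2 = 2 * (v ^+ 2 + z)].
  pose z := y / w.
  have yz : y = w * z by rewrite /z; field.
  have ez : z ^+ 2 = w ^+ 4 - N%:R.
    by rewrite /z expr_div_n cP ew /a; field.
  have eN : (w ^+ 2 - z) * (w ^+ 2 + z) = N%:R.
    by apply: subr0_eq; rewrite -[RHS](subrr (z ^+ 2)) {1}ez; ring.
  have u0 : w ^+ 2 + z != 0.
    by apply: contra N0 => /eqP e; rewrite -eN e mulr0.
  have [] := H1 (2 * (w ^+ 2 + z)) (4 * w * (w ^+ 2 + z)).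
  - by rewrite mulf_neq0.
  - have -> : N%:R = w ^+ 4 - z ^+ 2 by rewrite ez; ring.
    by ring.
  - by move=> [t et]; exists z, t, w; split; rewrite ?ew.
  move=> [t et]; exists (- z), (2 * N%:R / t), (- w).
  have t0 : t != 0 by rewrite -sqrf_eq0 -et !mulf_neq0.
  split; rewrite ?sqrrN ?ew ?mulrNN //; first by rewrite ez; ring.
  rewrite expr_div_n -et; apply: (mulIf u0).
  by rewrite -[RHS]mulrA eN; field; rewrite ?N0 ?u0.
have [t0 N_t] : t != 0 /\ N%:R = (2 * v ^+ 2 - t ^+ 2 / 2) * (t ^+ 2 / 2).
  have eN : (v ^+ 2 - z) * (v ^+ 2 + z) = N%:R.
    by apply: subr0_eq; rewrite -[RHS](subrr (z ^+ 2)) {1}et; ring.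
  split; last by rewrite ex -eN; field.
  rewrite -sqrf_eq0 ex mulf_neq0 //.
  by apply: contra N0 => /eqP e; rewrite -eN e mulr0.
have ez : z = t ^+ 2 / 2 - v ^+ 2 by rewrite ex; field.
have v0 : v != 0 by apply: contra x0 => /eqP v0; rewrite -ev v0 expr0n.
pose X := (t ^+ 2 + 2 * v * t) / 2.
have hX : on_curve a 0 (Some (X, t * X)).
  by apply/eqP; rewrite /a /X N_t; field.
have X0 : X != 0.
  have -> : X = t * (t + 2 * v) / 2 by rewrite /X; field.
  rewrite !mulf_neq0 //; apply: contra N0 => /eqP e.
  have et0 : t = - (2 * v) by apply: subr0_eq; rewrite -[RHS]e; ring.
  by rewrite N_t et0; apply/eqP; field.
exists (Point hX : E); apply: val_inj; rewrite mulr2n.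
change (pt_val P = add_raw a (Some (X, t * X)) (Some (X, t * X))); rewrite eP.
rewrite add_tangent; last exact: mulf_neq0.
have -> : (3 * X ^+ 2 + a) / (2 * (t * X)) = t + v.
  have d0 : 2 * (t * X) != 0 by rewrite mulf_neq0 // mulf_neq0.
  by apply: (mulIf d0); rewrite divfK // /a /X N_t; field.
congr (Some (_, _)).
  by rewrite -ev /X; field.
by rewrite ey ez /X; field.
Qed.

Definition point_height P : nat :=
  if pt_val P is Some (x, _) then height x else 1%N.

Lemma point_height_gt0 P : (0 < point_height P)%N.
Proof. by rewrite /point_height; case: (pt_val P) => [[x y]|] //; apply: height_gt0. Qed.

(** A point is determined up to sign by its abscissa. *)
Lemma point_height_northcott B : exists (F : finType) (f : E -> F), forall P Q,
  (point_height P <= B)%N -> (point_height Q <= B)%N -> f P = f Q ->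
  P = Q \/ P = - Q.
Proof.
(* numerators in [-B, B] are shifted by B *)
exists (option ('I_B.*2.+1 * 'I_B.+1)).
exists (fun P : E => if pt_val P is Some (x, _)
  then Some (inord (absz (numq x + B%:Z)), inord `|denq x|%N) else None).
move=> P Q; rewrite /point_height.
case eP: (pt_val P) => [[x1 y1]|]; case eQ: (pt_val Q) => [[x2 y2]|] //; last first.
  by move=> _ _ _; left; apply: val_inj; rewrite /= eP eQ.
rewrite /height !geq_max => /andP[n1 d1] /andP[n2 d2] [/(congr1 val) en /(congr1 val) ed].
rewrite /= !inordK in en ed; try lia.
have ex : x1 = x2.
  rewrite -[x1]divq_num_den -[x2]divq_num_den.
  have -> : numq x1 = numq x2 by lia.
  by have -> : denq x1 = denq x2 by have := denq_gt0 x1; have := denq_gt0 x2; lia.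
by rewrite -ex in eQ; apply: (abscissa_eq eP eQ).
Qed.

Lemma point_height_double P :
  (point_height P ^ 4 <= 16 * N ^ 3 * point_height (P *+ 2)%R)%N.
Proof.
have bound1 Q : (1 <= 16 * N ^ 3 * point_height Q)%N.
  by rewrite !muln_gt0 ?N_gt0 ?point_height_gt0.
case eP: (pt_val P) => [[x y]|]; last by rewrite {1}/point_height eP.
have [y0|y0] := eqVneq y 0; last first.
  have [x2 [y2 [e2 ex]]] := double_point eP y0.
  by rewrite /point_height eP e2; apply: height_double.
have e2 : P *+ 2 = 0.
  have eN : - P = P by apply: val_inj; rewrite /= eP y0 /= oppr0.
  by rewrite mulr2n -{1}eN addNr.
have [e|e] := torsion2 e2; rewrite {1}e.
  exact: bound1.
have -> : point_height origin_pt = 1%N by [].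
exact: bound1.
Qed.

Lemma point_height_translate Q : exists C, forall P,
  (point_height (P + Q)%R <= C * point_height P ^ 2)%N.
Proof.
case eQ: (pt_val Q) => [[x2 y2]|]; last first.
  have -> : Q = 0 by apply: val_inj.
  by exists 1%N => P; rewrite addr0 mul1n -mulnn leq_pmulr // point_height_gt0.
pose C := (((N + 2) * (`|numq x2| + `|denq x2|)) ^ 2)%N.
exists (C + (point_height Q + (point_height (Q *+ 2)%R + 1)))%N => P.
have le_const c D : (c <= D)%N -> (c <= D * point_height P ^ 2)%N.
  by move=> cD; apply: leq_trans cD _; rewrite leq_pmulr // expn_gt0 point_height_gt0.
have [ePQ|PQ] := eqVneq P Q.
  by apply: le_const; rewrite ePQ -mulr2n addnA addnCA leq_addr.
have [ePQ|PQ'] := eqVneq P (- Q).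
  by apply: le_const; rewrite ePQ addNr !addnA leq_addl.
case eP: (pt_val P) => [[x1 y1]|]; last first.
  by have -> : P = 0 by [apply: val_inj]; rewrite add0r /= muln1; lia.
have x12 : x1 != x2 := abscissa_neq eP eQ PQ PQ'.
have -> : point_height (P + Q) = height (((y2 - y1) / (x2 - x1)) ^+ 2 - x1 - x2).
  rewrite /point_height.
  have -> : pt_val (P + Q) = add_raw a (Some (x1, y1)) (Some (x2, y2)) by rewrite -eP -eQ.
  by rewrite add_chord.
have -> : point_height P = height x1 by rewrite /point_height eP.
apply: (@leq_trans (C * height x1 ^ 2)); last by rewrite leq_mul2r leq_addr orbT.
apply: height_translate => //.
have n0 : x2 - x1 != 0 by rewrite subr_eq0 eq_sym.
(* x(P + Q) and x(P - Q) are (S -+ 2 y1 y2) / (x2 - x1)^2 *)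
set S := (x1 + x2) * (x1 * x2 - N%:R).
have cP := curveP eP; have cQ := curveP eQ.
have -> : ((y2 - y1) / (x2 - x1)) ^+ 2 - x1 - x2 = (S - 2 * y1 * y2) / (x2 - x1) ^+ 2.
  have -> : S = y1 ^+ 2 + y2 ^+ 2 - (x1 + x2) * (x2 - x1) ^+ 2.
    by rewrite cP cQ /S /a; ring.
  by field.
have eS : S ^+ 2 - (2 * y1 * y2) ^+ 2 = (x1 * x2 + N%:R) ^+ 2 * (x2 - x1) ^+ 2.
  have -> : (2 * y1 * y2) ^+ 2 = 4 * (y1 ^+ 2 * y2 ^+ 2) by ring.
  by rewrite cP cQ /S /a; ring.
apply: (mulIf (expf_neq0 2 n0)); rewrite mul0r mulrDl -eS /S; by field.
Qed.

(** The first hypothesis bounds the descent image of the isogenous curve, the second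
    bounds that of E by the subgroup generated by - N and alpha R. *)
Theorem rank_one_criterion (R : E) :
  (forall x y : rat, x != 0 -> y ^+ 2 = x ^+ 3 + 4 * N%:R * x ->
    is_square x \/ is_square (N%:R * x)) ->
  (forall x y : rat, x != 0 -> y ^+ 2 = x ^+ 3 - N%:R * x ->
    [\/ is_square x, is_square (a * x), is_square (alpha R * x) |
        is_square (a * (alpha R * x))]) ->
  ~ is_square (alpha R) -> ~ is_square (a * alpha R) ->
  has_rank a 0 1.
Proof.
move=> H1 H2 nR naR.
have aT : alpha origin_pt = a by rewrite /alpha /=.
have origin_pt2 : origin_pt *~ 2 = 0.
  by rewrite -[origin_pt *~ 2]/(origin_pt + origin_pt) -{1}opp_origin_pt addNr.
have halve P Q : is_square (alpha Q * alpha P) -> exists P', P + Q = P' *+ 2.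
  move=> sq; apply: halving => //; move: (alphaD P Q); rewrite mulrC [alpha P * _]mulrC.
  by apply: is_square_cancel => //; rewrite mulf_neq0 // alpha_neq0.
have [C0 hC0] := point_height_translate 0.
have [C1 hC1] := point_height_translate origin_pt.
have [C2 hC2] := point_height_translate R.
have [C3 hC3] := point_height_translate (origin_pt + R).
pose C := (C0 + C1 + C2 + C3)%N.
apply: (@has_rank1 _ _ nonsingularN R).
  move=> n n0; apply: (@nontorsion E R origin_pt alpha alpha_neq0) => //.
  - by exists 1.
  - exact: alphaD.
  - exact: torsion2.
  - rewrite aT => -[w ew]; have : 0 <= a by rewrite ew sqr_ge0.
    by rewrite oppr_ge0 lern0 => /eqP N_0; move: N_gt0; rewrite N_0.
apply: (@relation_to_generator _ R origin_pt point_height (16 * N ^ 3 * C)) => //.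
  exact: point_height_northcott.
move=> P.
have [Q [i [j [eQ sq hQ]]]] : exists Q (i j : int), [/\ Q = R *~ i + origin_pt *~ j,
   is_square (alpha Q * alpha P) & (point_height (P + Q)%R <= C * point_height P ^ 2)%N].
  have bound c D : (c <= D * point_height P ^ 2)%N -> (D <= C)%N ->
      (c <= C * point_height P ^ 2)%N.
    by move=> h1 h2; apply: leq_trans h1 _; rewrite leq_mul2r h2 orbT.
  have : [\/ is_square (alpha P), is_square (a * alpha P), is_square (alpha R * alpha P) |
          is_square (a * (alpha R * alpha P))].
    case eP: (pt_val P) => [[x y]|]; last first.
      have -> : P = 0 by apply: val_inj.
      by apply: Or41; exists 1.
    have [x0|x0] := eqVneq x 0.
      by rewrite x0 in eP; rewrite (eq_origin_pt eP) aT; apply: Or42; exists a.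
    have -> : alpha P = x by rewrite /alpha eP (negPf x0).
    by apply: (H2 x y) => //; rewrite (curveP eP) /a mulNr.
  case=> sq.
  - exists 0, 0, 0; split; first by rewrite addr0.
      by rewrite {1}/alpha /= mul1r.
    by apply: bound (hC0 P) _; rewrite /C; lia.
  - exists origin_pt, 0, 1; split; first by rewrite add0r.
      by rewrite aT.
    by apply: bound (hC1 P) _; rewrite /C; lia.
  - exists R, 1, 0; split => //; first by rewrite addr0.
    by apply: bound (hC2 P) _; rewrite /C; lia.
  exists (origin_pt + R), 1, 1; split; first by rewrite addrC.
    have := is_squareM (alphaD origin_pt R) sq; rewrite aT.
    have -> : alpha (origin_pt + R) * (a * alpha R) * (a * (alpha R * alpha P)) =
      (a * alpha R) ^+ 2 * (alpha (origin_pt + R) * alpha P) by ring.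
    apply: is_square_cancel (is_square_sqr _).
    by rewrite expf_neq0 // mulf_neq0 ?alpha_neq0 // oppr_eq0.
  by apply: bound (hC3 P) _; rewrite /C; lia.
have [P' eP'] := halve _ _ sq.
exists P', (- i), (- j); split.
  by rewrite -{1}[P](addrK Q) eP' eQ !mulrNz opprD addrA.
rewrite -leq_sqr -expnM expnMn; apply: leq_trans (point_height_double P') _.
rewrite -eP'; apply: (@leq_trans (16 * N ^ 3 * (C * point_height P ^ 2))).
  by rewrite leq_mul2l hQ orbT.
rewrite mulnA leq_mul2r; apply/orP; right.
by case: (16 * N ^ 3 * C)%N => // k; rewrite leq_pmulr.
Qed.
End Curve.

(** * Quadratic residues modulo p *)

(** Stated for an arbitrary modulus, since the descent in [bad_nonresidue] passes
    through composite cofactors. *)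
Definition QR (c : int) (p : nat) : Prop := exists z : int, (p%:Z %| z ^+ 2 - c)%Z.

Lemma QR_dvd c p f : (f %| p)%N -> QR c p -> QR c f.
Proof.
move=> fp [z hz]; exists z; apply: dvdz_trans hz.
by rewrite dvdzE.
Qed.

(** z and p - z have opposite parities, as p is odd. *)
Lemma QR_small c p (par : bool) : prime p -> odd p -> ~~ (p%:Z %| c)%Z -> QR c p ->
  exists z : nat, [/\ (0 < z)%N, (z < p)%N, odd z = par & (p%:Z %| z%:Z ^+ 2 - c)%Z].
Proof.
move=> pp op pc [z hz].
have p0 : (p%:Z != 0) by have := prime_gt0 pp; lia.
pose r := (z %% p)%Z; pose k := (z %/ p)%Z.
have ez : z = k * p + r by apply: divz_eq.
have r0 : 0 <= r by apply: modz_ge0.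
have rp : r < p by apply: ltz_pmod; have := prime_gt0 pp; lia.
have hr : (p%:Z %| r ^+ 2 - c)%Z.
  have -> : r ^+ 2 - c = (z ^+ 2 - c) - (k * (k * p + 2 * r)) * p by rewrite ez; ring.
  by rewrite rpredB // dvdz_mull.
have rn0 : r != 0.
  by apply: contra pc => /eqP r_0; move: hr; rewrite r_0 expr0n sub0r rpredN.
have [m em] : exists m : nat, r = m%:Z by exists `|r|%N; lia.
rewrite em in r0 rp hr rn0.
have [om|om] := eqVneq (odd m) par.
  by exists m; split => //; lia.
exists (p - m)%N; split; [lia|lia| |].
  rewrite oddB ?op; last by lia.
  by case: (odd m) par om => -[].
have -> : (p - m)%N%:Z = p%:Z - m%:Z by lia.
have -> : (p%:Z - m%:Z) ^+ 2 - c = (m%:Z ^+ 2 - c) + (p%:Z - 2 * m%:Z) * p%:Z by ring.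
by rewrite rpredD // dvdz_mull.
Qed.

Section Descent.
Variables (c : int) (bad : pred nat).
Hypothesis bad1 : ~~ bad 1.
Hypothesis badM : forall m k, bad (m * k)%N -> bad m || bad k.
Hypothesis bad_step : forall p, prime p -> bad p -> QR c p ->
  exists f, [/\ (0 < f)%N, (f < p)%N, bad f & QR c f].

Lemma bad_prime_factor n : (0 < n)%N -> bad n ->
  exists l, [/\ prime l, (l %| n)%N & bad l].
Proof.
elim/ltn_ind: n => n IH n0 bn.
have n1 : (1 < n)%N by case: n n0 bn {IH} => [|[|n]] //; rewrite (negPf bad1).
have lp := pdiv_prime n1; have ln := pdiv_dvd n.
have en : (n = pdiv n * (n %/ pdiv n))%N by rewrite mulnC divnK.
have /orP[bl|bk] : bad (pdiv n) || bad (n %/ pdiv n)%N by apply: badM; rewrite -en.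
  by exists (pdiv n).
have [||l [pl lk bl]] := IH _ _ _ bk.
- by rewrite ltn_Pdiv ?prime_gt1.
- by rewrite divn_gt0 ?prime_gt0 // dvdn_leq.
by exists l; split => //; rewrite en dvdn_mull.
Qed.

(** Fermat's descent.  If every bad prime for which c is a square yields a smaller
    bad number with the same property, that number has a bad prime factor because
    good numbers are closed under multiplication, and the argument repeats. *)
Lemma bad_nonresidue p : prime p -> bad p -> ~ QR c p.
Proof.
elim/ltn_ind: p => p IH pp bp qr.
have [f [f0 fp bf qf]] := bad_step pp bp qr.
have [l [pl lf bl]] := bad_prime_factor f0 bf.
apply: (IH l _ pl bl (QR_dvd lf qf)).
by apply: leq_ltn_trans fp; apply: dvdn_leq.
Qed.
End Descent.

Lemma mod8_check1 (P : nat -> bool) :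
  all P (iota 0 8) -> forall m : nat, P (m %% 8)%N.
Proof. by move=> /allP h m; apply: h; rewrite mem_iota ltn_pmod. Qed.

Lemma mod8_check (P : nat -> nat -> bool) :
  all (fun i => all (P i) (iota 0 8)) (iota 0 8) ->
  forall m k : nat, P (m %% 8)%N (k %% 8)%N.
Proof. by move=> h m k; apply: mod8_check1; apply: (mod8_check1 h). Qed.

Lemma bad_mul (s : seq nat) :
  all (fun i => all (fun j => (((i * j) %% 8)%N \in s) ==> ((i \in s) || (j \in s)))
    (iota 0 8)) (iota 0 8) ->
  forall m k : nat, ((m * k) %% 8)%N \in s -> ((m %% 8)%N \in s) || ((k %% 8)%N \in s).
Proof.
move=> h m k; rewrite -modnMm; apply/implyP.
exact: (mod8_check h).
Qed.

(** Dividing z^2 - c by p leaves a cofactor below p, since z <= p - 1 and |c| is small. *)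
Lemma smaller_cofactor (c : int) (z p : nat) : (-2 <= c <= 2) -> (z < p)%N ->
  0 < z%:Z ^+ 2 - c -> (2 < p)%N -> (p%:Z %| z%:Z ^+ 2 - c)%Z ->
  exists f, [/\ (0 < f)%N, (f < p)%N, z%:Z ^+ 2 - c = (p * f)%N%:Z & QR c f].
Proof.
move=> /andP[c1 c2] zp pos p2 /dvdzP[k ek].
have k0 : 0 < k by rewrite ek pmulr_lgt0 in pos; [|lia].
have [f ef] : exists f : nat, k = f%:Z by exists `|k|%N; lia.
rewrite ef in ek k0; exists f; split; first by [].
- rewrite -(ltn_pmul2r (_ : (0 < p)%N)); last by lia.
  have : z%:Z ^+ 2 <= (p%:Z - 1) ^+ 2 by rewrite ler_sqr ?nnegrE; lia.
  rewrite sqrrB1 => h; rewrite -ltz_nat !PoszM -ek.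
  have -> : p%:Z * p%:Z = p%:Z ^+ 2 by [].
  lia.
- by rewrite ek mulrC PoszM.
by exists z%:Z; rewrite ek dvdz_mulr.
Qed.

Lemma odd_sqr_mod8 z : odd z -> (z ^ 2 %% 8 = 1)%N.
Proof.
move=> oz; rewrite -modnXm; apply/eqP.
have := isT : all (fun i => odd i ==> (i ^ 2 %% 8 == 1)%N) (iota 0 8).
by move/mod8_check1/(_ z); rewrite odd_mod // oz.
Qed.

Lemma prime_not_dvd_small c p : prime p -> (2 < p)%N -> (-2 <= c <= 2) -> c != 0 ->
  ~~ (p%:Z %| c)%Z.
Proof.
move=> pp p2 hc c0; rewrite dvdzE absz_nat; apply/negP => /dvdn_leq; lia.
Qed.

Lemma odd_mod8 (p : nat) s : all odd s -> (p %% 8)%N \in s -> odd p.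
Proof. by move=> /allP h /h; rewrite odd_mod. Qed.

(** For z even, p f = z^2 + 1 is 1 modulo 4, so f is 3 modulo 4 along with p. *)
Lemma nonresidueN1 p : prime p -> (p %% 8)%N \in [:: 3; 7]%N -> ~ QR (-1) p.
Proof.
move=> pp bp; apply: (@bad_nonresidue _ (fun n => (n %% 8)%N \in [:: 3; 7]%N)) => //.
  by apply: bad_mul.
move=> {pp bp} {}p pp bp qr.
have op : odd p by apply: odd_mod8 bp.
have p2 : (2 < p)%N by rewrite odd_prime_gt2.
have [|z [z0 zp oz dz]] := QR_small false pp op _ qr; first by apply: prime_not_dvd_small.
have [||f [f0 fp ef qf]] := smaller_cofactor _ zp _ p2 dz; try (by []); first by lia.
exists f; split => //.
have e : (p * f = z ^ 2 + 1)%N by lia.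
have := @mod8_check (fun i j => (((i * j) %% 4)%N == 1%N) ==>
  (i \in [:: 3; 7]%N) ==> (j \in [:: 3; 7]%N)) isT p f.
have -> : ((p %% 8) * (f %% 8) %% 4 = (p * f) %% 4)%N.
  by rewrite -modnMm !modn_dvdm // modnMm.
have -> : (p * f %% 4 = 1)%N.
  by rewrite e -(odd_double_half z) oz add0n -mul2n expnMn [(2 ^ 2 * _)%N]mulnC modnMDl.
by rewrite bp.
Qed.

(** For z odd, p f = z^2 - 2 is 7 modulo 8, so f is 3 or 5 modulo 8 along with p. *)
Lemma nonresidue2 p : prime p -> (p %% 8)%N \in [:: 3; 5]%N -> ~ QR 2 p.
Proof.
move=> pp bp; apply: (@bad_nonresidue _ (fun n => (n %% 8)%N \in [:: 3; 5]%N)) => //.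
  by apply: bad_mul.
move=> {pp bp} {}p pp bp qr.
have op : odd p by apply: odd_mod8 bp.
have p2 : (2 < p)%N by rewrite odd_prime_gt2.
have [|z [z0 zp oz dz]] := QR_small true pp op _ qr; first by apply: prime_not_dvd_small.
have z1 : (1 < z)%N.
  rewrite ltn_neqAle eq_sym z0 andbT; apply/eqP => z1; rewrite z1 in dz.
  have : (p%:Z %| -1)%Z by [].
  by apply/negP; apply: prime_not_dvd_small.
have [||f [f0 fp ef qf]] := smaller_cofactor _ zp _ p2 dz; try (by []); first by nia.
exists f; split => //.
have e : (p * f + 2 = z ^ 2)%N by lia.
have := @mod8_check (fun i j => (((i * j + 2) %% 8)%N == 1%N) ==> (i \in [:: 3; 5]%N) ==> (j \in [:: 3; 5]%N)) isT p f.
by rewrite bp /= -modnDml modnMm modnDml e odd_sqr_mod8.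
Qed.

(** For z odd, p f = z^2 + 2 is 3 modulo 8, so f is 5 or 7 modulo 8 along with p. *)
Lemma nonresidueN2 p : prime p -> (p %% 8)%N \in [:: 5; 7]%N -> ~ QR (-2) p.
Proof.
move=> pp bp; apply: (@bad_nonresidue _ (fun n => (n %% 8)%N \in [:: 5; 7]%N)) => //.
  by apply: bad_mul.
move=> {pp bp} {}p pp bp qr.
have op : odd p by apply: odd_mod8 bp.
have p2 : (2 < p)%N by rewrite odd_prime_gt2.
have [|z [z0 zp oz dz]] := QR_small true pp op _ qr; first by apply: prime_not_dvd_small.
have [||f [f0 fp ef qf]] := smaller_cofactor _ zp _ p2 dz; try (by []); first by lia.
exists f; split => //.
have e : (p * f = z ^ 2 + 2)%N by lia.
have := @mod8_check (fun i j => (((i * j) %% 8)%N == 3%N) ==> (i \in [:: 5; 7]%N) ==> (j \in [:: 5; 7]%N)) isT p f.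
by rewrite bp /= modnMm e -modnDml odd_sqr_mod8.
Qed.

(** * Homogeneous spaces *)

(** The root is the gcd of a and z. *)
Lemma coprime_square_factor (a b z : nat) :
  coprime a b -> (a * b = z ^ 2)%N -> exists r, (a = r ^ 2)%N.
Proof.
move=> co e; have [a0|a0] := posnP a; first by exists 0%N; rewrite a0.
set g := gcdn a z; exists g.
have g0 : (0 < g)%N by rewrite gcdn_gt0 a0.
have [ga gz] : (g %| a)%N /\ (g %| z)%N by rewrite dvdn_gcdl dvdn_gcdr.
pose a' := (a %/ g)%N; pose z' := (z %/ g)%N.
have ea : (a = a' * g)%N by rewrite divnK.
have ez : (z = z' * g)%N by rewrite divnK.
have co' : coprime a' z'.
  by rewrite /coprime -(eqn_pmul2r g0) mul1n muln_gcdl -ea -ez.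
have e' : (a' * b = z' ^ 2 * g)%N.
  apply/eqP; rewrite -(eqn_pmul2r g0) mulnAC -ea e ez expnMn -mulnA mulnn //.
have a'g : (a' %| g)%N.
  by rewrite -(Gauss_dvdr _ (coprimeXr 2 co')) -e' dvdn_mulr.
have ga' : (g %| a')%N.
  by rewrite -(Gauss_dvdl _ (coprime_dvdl ga co)) e' dvdn_mull.
have -> : (g ^ 2 = a' * g)%N; last by [].
by rewrite -mulnn; congr (_ * _)%N; apply/eqP; rewrite eqn_dvd ga' a'g.
Qed.

Lemma coprimez_square_factor (a b z : int) : coprimez a b -> a * b = z ^+ 2 ->
  exists r : int, `|a| = r ^+ 2.
Proof.
move=> co e; have [||r er] := @coprime_square_factor `|a| `|b| `|z|.
- by [].
- by rewrite -abszM e abszX.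
by exists r%:Z; rewrite -abszE er -mulnn PoszM expr2.
Qed.

Lemma rat_sqrt_int (x : rat) (k : int) : x ^+ 2 = k%:~R -> exists m : int, x = m%:~R.
Proof.
move=> e; exists (numq x).
have d0 : (denq x)%:~R != 0 :> rat by rewrite intr_eq0 denq_neq0.
have e2 : numq x ^+ 2 = k * denq x ^+ 2.
  apply/eqP; rewrite -(eqr_int rat) intrM !rmorphXn /= -e; apply/eqP.
  by rewrite -exprMn -{2}[x]divq_num_den mulfVK.
have : (denq x %| 1)%Z.
  have co : coprimez (denq x) (numq x ^+ 2).
    by rewrite coprimezXr // coprimez_sym; apply: coprime_num_den.
  rewrite -(Gauss_dvdzl _ co) mul1r e2 expr2 mulrA dvdz_mull //.
rewrite dvdz1 => /eqP d1.
have {}d1 : denq x = 1 by have := denq_gt0 x; lia.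
by rewrite -{1}[x]divq_num_den d1 divr1.
Qed.

(** Solvability of the homogeneous space attached to d; the coprimality conditions
    are those that a point in lowest terms provides. *)
Definition torsor (d c : int) : Prop := exists M e n : int,
  [/\ d * M ^+ 4 + c * e ^+ 4 = n ^+ 2, coprimez M e, coprimez M c & coprimez e d].

(** In lowest terms x = u / e^2.  Removing g = gcd(u, b) from u (u^2 + b e^4), a
    square, leaves two coprime factors, which are squares up to sign. *)
Lemma torsor_of_point (b : int) (x y : rat) : b != 0 -> x != 0 ->
  y ^+ 2 = x ^+ 3 + b%:~R * x ->
  exists d c M e n : int, [/\ d * c = b, e != 0, x = d%:~R * (M%:~R / e%:~R) ^+ 2,
   d * M ^+ 4 + c * e ^+ 4 = n ^+ 2 & [/\ coprimez M e, coprimez M c & coprimez e d]].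
Proof.
move=> b0 x0 exy.
have xuv : x = (numq x)%:~R / (denq x)%:~R by rewrite divq_num_den.
have couv : coprimez (numq x) (denq x) by apply: coprime_num_den.
have v0 := denq_gt0 x.
move: (numq x) (denq x) xuv couv v0 => u v xuv couv v0.
have v0' : v%:~R != 0 :> rat by rewrite intr_eq0 gt_eqF.
have u0 : u != 0 by apply: contra x0 => /eqP u0; rewrite xuv u0 mul0r.
have [Z eZ] : exists Z : int, y * v%:~R ^+ 2 = Z%:~R.
  apply: (@rat_sqrt_int _ (v * (u ^+ 3 + b * u * v ^+ 2))).
  by rewrite exprMn exy xuv !(rmorphD, rmorphM, rmorphXn) /=; field.
have [e ev] : exists e : int, v = e ^+ 2.
  have [||r er] := @coprimez_square_factor v (u ^+ 3 + b * u * v ^+ 2) Z.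
  - have -> : u ^+ 3 + b * u * v ^+ 2 = (b * u * v) * v + u ^+ 3 by ring.
    rewrite /coprimez gcdzMDl -/(coprimez _ _) coprimezXr //.
    by rewrite coprimez_sym.
  - apply/eqP; rewrite -(eqr_int rat) rmorphXn /= -eZ exprMn exy xuv; apply/eqP.
    by rewrite !(rmorphD, rmorphM, rmorphXn) /=; field.
  by exists r; rewrite -er gtr0_norm.
have e0 : e != 0 by apply: contraL v0 => /eqP e0; rewrite ev e0 expr0n.
have e0' : e%:~R != 0 :> rat by rewrite intr_eq0.
have co_ue : coprimez u e.
  by move: couv; rewrite ev expr2 coprimezMr => /andP[].
have [w ew] : exists w : int, y * e%:~R ^+ 3 = w%:~R.
  apply: (@rat_sqrt_int _ (u * (u ^+ 2 + b * e ^+ 4))).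
  by rewrite exprMn exy xuv ev !(rmorphD, rmorphM, rmorphXn) /=; field.
have {}ew : u * (u ^+ 2 + b * e ^+ 4) = w ^+ 2.
  apply/eqP; rewrite -(eqr_int rat) rmorphXn /= -ew exprMn exy xuv ev; apply/eqP.
  by rewrite !(rmorphD, rmorphM, rmorphXn) /=; field.
pose g := gcdz u b.
have g0 : g != 0 by rewrite gcdz_eq0 negb_and u0.
have [u1 eu] : exists k, u = k * g by apply/dvdzP; apply: dvdz_gcdl.
have [b1 eb] : exists k, b = k * g by apply/dvdzP; apply: dvdz_gcdr.
have co1 : coprimez u1 b1.
  have h : gcdz u1 b1 * `|g|%:Z = g by rewrite mulz_gcdl -eu -eb.
  by apply/eqP/(mulIf g0); rewrite mul1r -[RHS]h.
have [w1 ew1] : exists k, w = k * g.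
  apply/dvdzP; rewrite dvdzE -(@dvdn_pexp2r _ _ 2) // -!abszX -dvdzE -ew eu {1}eb.
  apply/dvdzP; exists (u1 * (u1 ^+ 2 * g + b1 * e ^+ 4)); ring.
have e1 : u1 * (g * u1 ^+ 2 + b1 * e ^+ 4) = w1 ^+ 2.
  apply: (mulIf (expf_neq0 2 g0)); rewrite -exprMn -ew1 -ew {1 2}eu [b in RHS]eb.
  by ring.
have u10 : u1 != 0 by apply: contra u0 => /eqP h; rewrite eu h mul0r.
have [co_u1e co_ge] : coprimez u1 e /\ coprimez e g.
  by move: co_ue; rewrite eu coprimezMl [coprimez g _]coprimez_sym => /andP[].
have co2 : coprimez u1 (g * u1 ^+ 2 + b1 * e ^+ 4).
  have -> : g * u1 ^+ 2 + b1 * e ^+ 4 = (g * u1) * u1 + b1 * e ^+ 4 by ring.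
  by rewrite /coprimez gcdzMDl -/(coprimez _ _) coprimezMr co1 coprimezXr.
have [M eM] := coprimez_square_factor co2 e1.
have [n en] : exists r : int, `|g * u1 ^+ 2 + b1 * e ^+ 4| = r ^+ 2.
  by apply: (@coprimez_square_factor _ u1 w1); rewrite 1?coprimez_sym // mulrC.
have [sg [sg1 esg]] : exists sg : int, (sg = 1 \/ sg = -1) /\ `|u1| = sg * u1.
  case: (ler0P u1) => _; last by exists 1; rewrite mul1r; split; [left|].
  by exists (-1); rewrite mulN1r; split; [right|].
have sg2 : sg * sg = 1 by case: sg1 => ->.
have coM (k : int) : coprimez u1 k -> coprimez M k.
  move=> h; rewrite -(@coprimez_pexpl 2) // -eM.
  by rewrite coprimezE absz_id -coprimezE.
have cosg (k l : int) : coprimez k l -> coprimez k (sg * l).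
  by case: sg1 => ->; rewrite ?mul1r ?mulN1r ?coprimezN.
exists (sg * g), (sg * b1), M, e, n; split => //.
- by rewrite mulrACA sg2 mul1r mulrC -eb.
- rewrite expr_div_n mulrA -!rmorphXn -rmorphM /= -eM esg -ev xuv eu.
  by congr (_%:~R / _); rewrite mulrACA sg2 mul1r mulrC.
- have eW : sg * g * M ^+ 4 + sg * b1 * e ^+ 4 = sg * (g * u1 ^+ 2 + b1 * e ^+ 4).
    have -> : M ^+ 4 = (sg * sg) * u1 ^+ 2 by rewrite -[4%N]/(2 * 2)%N exprM -eM esg; ring.
    by rewrite sg2; ring.
  rewrite eW -en -[RHS](_ : `|sg * (g * u1 ^+ 2 + b1 * e ^+ 4)| = _); last first.
    by rewrite normrM; case: sg1 => ->; rewrite ?normrN normr1 mul1r.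
  rewrite ger0_norm //.
  have u1p : 0 < `|u1| by rewrite normr_gt0.
  rewrite -(pmulr_rge0 _ u1p) esg.
  have -> : sg * u1 * (sg * (g * u1 ^+ 2 + b1 * e ^+ 4)) =
     (sg * sg) * (u1 * (g * u1 ^+ 2 + b1 * e ^+ 4)) by ring.
  by rewrite sg2 mul1r e1 sqr_ge0.
by split; rewrite ?coM ?cosg.
Qed.

Lemma torsor_sym d c : torsor d c -> torsor c d.
Proof.
move=> [M [e [n [eq h1 h2 h3]]]]; exists e, M, n; split => //.
  by rewrite addrC.
by rewrite coprimez_sym.
Qed.

Lemma coprimez_prime (p : nat) (m c : int) : prime p -> (p%:Z %| c)%Z -> coprimez m c ->
  ~~ (p%:Z %| m)%Z.
Proof.
move=> pp pc co; apply/negP => pm.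
have : (p%:Z %| gcdz m c)%Z by rewrite dvdz_gcd pm.
by rewrite (eqP co) dvdz1 absz_nat => /eqP p1; rewrite p1 in pp.
Qed.

(** Modulo p the equation reads d M^4 = n^2, and M is invertible. *)
Lemma torsor_QR d c p : prime p -> (p%:Z %| c)%Z -> torsor d c -> QR d p.
Proof.
move=> pp pc [M [e [n [eq h1 h2 h3]]]].
have pM := coprimez_prime pp pc h2.
have coM : coprimez (M ^+ 2) p%:Z.
  rewrite coprimezXl // coprimez_sym /coprimez.
  by rewrite -[gcdz _ _]/(gcdn p `|M|)%:Z; move: pM; rewrite dvdzE absz_nat -prime_coprime.
have /coprimezP [[u v] /= uv] := coM.
exists (n * u).
have -> : (n * u) ^+ 2 - d = (n ^+ 2 - d * M ^+ 4) * u ^+ 2 - d * (1 - (u * M ^+ 2) ^+ 2) by ring.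
have -> : 1 - (u * M ^+ 2) ^+ 2 = (v * (1 + u * M ^+ 2)) * p.
  have vp : v * p = 1 - u * M ^+ 2 by rewrite -uv addrAC subrr add0r.
  by rewrite mulrAC vp; ring.
have -> : n ^+ 2 - d * M ^+ 4 = c * e ^+ 4 by rewrite -eq addrC addKr.
rewrite rpredB //; first by rewrite -mulrA dvdz_mulr.
by rewrite mulrA dvdz_mull.
Qed.

Lemma odd_sqr_mod8z (M : int) : ~~ (2 %| M)%Z -> exists k, M ^+ 2 = 8 * k + 1.
Proof.
move=> oM; have [j [->|->]] : exists j, M = 4 * j + 1 \/ M = 4 * j + 3.
- by exists (M %/ 4)%Z; lia.
- by exists (2 * j ^+ 2 + j); ring.
by exists (2 * j ^+ 2 + 3 * j + 1); ring.
Qed.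

Lemma odd_fourth_mod8 (M : int) : ~~ (2 %| M)%Z -> exists k, M ^+ 4 = 8 * k + 1.
Proof.
move=> /odd_sqr_mod8z [k ek]; exists (8 * k ^+ 2 + 2 * k).
by rewrite -[4%N]/(2 * 2)%N exprM ek; ring.
Qed.

(** M and n are odd, so M^4 and n^2 are 1 modulo 8; the two outcomes correspond to
    e even and e odd. *)
Lemma torsor_mod8 d c : (2 %| c)%Z -> ~~ (2 %| d)%Z -> torsor d c ->
  exists k, d = 8 * k + 1 \/ d + c = 8 * k + 1.
Proof.
move=> c2 d2 [M [e [n [eq h1 h2 h3]]]].
have M2 : ~~ (2 %| M)%Z by apply: (@coprimez_prime 2 _ c).
have [k ek] := odd_fourth_mod8 M2.
have n2 : ~~ (2 %| n)%Z.
  have [c' ec] := dvdzP c2.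
  have e1 : n ^+ 2 = 2 * (4 * d * k + c' * e ^+ 4) + d by rewrite -eq ek ec; ring.
  apply: contra d2 => /dvdzP [n' en].
  have -> : d = n ^+ 2 - 2 * (4 * d * k + c' * e ^+ 4) by rewrite e1; ring.
  by rewrite rpredB ?dvdz_mulr // en dvdz_mull.
have [j ej] := odd_sqr_mod8z n2.
have [/dvdzP [e' ee]|e2] := boolP (2 %| e)%Z.
  exists (j - d * k - 2 * c * e' ^+ 4); left; apply: subr0_eq.
  have : d * M ^+ 4 + c * e ^+ 4 - n ^+ 2 = 0 by rewrite eq subrr.
  by rewrite ek ej ee => <-; ring.
have [l el] := odd_fourth_mod8 e2.
exists (j - d * k - c * l); right; apply: subr0_eq.
have : d * M ^+ 4 + c * e ^+ 4 - n ^+ 2 = 0 by rewrite eq subrr.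
by rewrite ek ej el => <-; ring.
Qed.

(** M is odd, so the left-hand side is 2 modulo 4. *)
Lemma torsor_mod4 d c : (2 %| d)%Z -> ~~ (4 %| d)%Z -> (4 %| c)%Z -> torsor d c -> False.
Proof.
move=> /dvdzP [d' ed] d4 /dvdzP [c' ec] [M [e [n [eq h1 h2 h3]]]].
have M2 : ~~ (2 %| M)%Z.
  by apply: (@coprimez_prime 2 _ c) => //; rewrite ec; apply: dvdz_mull.
have [k ek] := odd_fourth_mod8 M2.
have [/dvdzP [n' en]|n2] := boolP (2 %| n)%Z.
  move/negP: d4; apply; apply/dvdzP; exists (n' ^+ 2 - 4 * d' * k - c' * e ^+ 4).
  apply: subr0_eq; have : d * M ^+ 4 + c * e ^+ 4 - n ^+ 2 = 0 by rewrite eq subrr.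
  by rewrite ek en ec ed => <-; ring.
have [j ej] := odd_sqr_mod8z n2.
have : 2 * (d' * (8 * k + 1) + 2 * c' * e ^+ 4 - 4 * j) = 1.
  apply: subr0_eq; have : d * M ^+ 4 + c * e ^+ 4 - n ^+ 2 = 0 by rewrite eq subrr.
  by rewrite ek ej ec ed => <-; ring.
move: (_ - _) => t; lia.
Qed.

(** * The two Selmer computations *)

Lemma split_prime (l : nat) (d c k : int) : prime l -> d * c = l%:Z * k ->
  (exists2 d', d = l%:Z * d' & d' * c = k) \/ (exists2 c', c = l%:Z * c' & d * c' = k).
Proof.
move=> pl e; have l0 : l%:Z != 0 by have := prime_gt0 pl; lia.
have : (l%:Z %| d * c)%Z by rewrite e dvdz_mulr.
rewrite dvdzE abszM absz_nat Euclid_dvdM //.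
rewrite -[(l %| `|d|)%N]/(l%:Z %| d)%Z -[(l %| `|c|)%N]/(l%:Z %| c)%Z.
case/orP => /dvdzP [x ex]; [left|right]; exists x; rewrite 1?mulrC //.
  by apply: (mulfI l0); rewrite -e ex; ring.
by apply: (mulfI l0); rewrite -e ex; ring.
Qed.

Lemma mul_eqN1 (d c : int) : d * c = -1 -> d = 1 /\ c = -1 \/ d = -1 /\ c = 1.
Proof.
move=> e; have : (d %| 1)%Z by apply/dvdzP; exists (- c); rewrite mulNr mulrC e.
rewrite dvdz1 => /eqP d1.
have [h|h] : d = 1 \/ d = -1 by lia.
  by left; rewrite h mul1r in e.
by right; rewrite h mulN1r in e; split => //; lia.
Qed.

(** The factorisations D C = - 2pq, one from each pair {(D, C), (C, D)}. *)
Definition torsor_candidate (p q : nat) (D C : int) : Prop :=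
  [\/ D = 1, D = -1 /\ C = 2 * p%:Z * q%:Z, D = 2 /\ C = - (p%:Z * q%:Z) |
   [\/ D = -2 /\ C = p%:Z * q%:Z, D = p%:Z /\ C = - (2 * q%:Z), D = - p%:Z /\ C = 2 * q%:Z |
      D = q%:Z /\ C = - (2 * p%:Z) \/ D = - q%:Z /\ C = 2 * p%:Z]].

Lemma torsor_cases (p q : nat) (d c : int) : prime p -> prime q ->
  d * c = - (2 * p%:Z * q%:Z) -> torsor d c ->
  exists D C : int, [/\ torsor D C, d = D \/ c = D &
   torsor_candidate p q D C].
Proof.
move=> pp pq e tor; have tor' := torsor_sym tor.
have e2 : d * c = 2%:Z * (p%:Z * (q%:Z * -1)) by rewrite e; ring.
pose good D := exists C : int, torsor D C /\
   torsor_candidate p q D C.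
suff [[C [t h]]|[C [t h]]] : good d \/ good c.
- by exists d, C; split; [|left|].
- by exists c, C; split; [|right|].
have [[x2 ? e3]|[x2 ? e3]] := @split_prime 2 _ _ _ isT e2;
have [[x3 ? e4]|[x3 ? e4]] := split_prime pp e3;
have [[x4 ? e5]|[x4 ? e5]] := split_prime pq e4;
have [[? ?]|[? ?]] := mul_eqN1 e5; subst;
solve [ (left; eexists; split; [exact: tor|]) + (right; eexists; split; [exact: tor'|]);
  rewrite /torsor_candidate; 
  solve [ apply: Or41; ring | apply: Or42; split; ring | apply: Or43; split; ring
        | apply: Or44; solve [ apply: Or41; split; ring | apply: Or42; split; ring
          | apply: Or43; split; ring | apply: Or44; left; split; ring
          | apply: Or44; right; split; ring ] ] ].
Qed.

(** With both coefficients negative, the left-hand side is negative or M = e = 0. *)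
Lemma torsor_pos d c : 0 < d * c -> torsor d c -> 0 < d.
Proof.
move=> dc [M [e [n [eq co _ _]]]]; rewrite ltNge; apply/negP => d0.
have {}d0 : d < 0 by rewrite lt_neqAle d0 andbT; apply: contraTN dc => /eqP ->; rewrite mul0r ltxx.
have c0 : c < 0 by rewrite nmulr_rgt0 in dc.
have M4 : 0 <= M ^+ 4 by rewrite exprn_even_ge0.
have e4 : 0 <= e ^+ 4 by rewrite exprn_even_ge0.
have n2 : 0 <= n ^+ 2 by rewrite sqr_ge0.
have h1 : d * M ^+ 4 <= 0 by rewrite mulr_le0_ge0 // ltW.
have h2 : c * e ^+ 4 <= 0 by rewrite mulr_le0_ge0 // ltW.
have M40 : M ^+ 4 = 0.
  have : d * M ^+ 4 = 0 by lia.
  by move/eqP; rewrite mulf_eq0 lt_eqF //= => /eqP.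
have e40 : e ^+ 4 = 0.
  have : c * e ^+ 4 = 0 by lia.
  by move/eqP; rewrite mulf_eq0 (lt_eqF c0) /= => /eqP.
move: co; have /eqP := M40; rewrite expf_eq0 /= => /eqP ->.
by have /eqP := e40; rewrite expf_eq0 /= => /eqP ->.
Qed.

Lemma mul_eq1 (d c : int) : d * c = 1 -> d = 1 /\ c = 1 \/ d = -1 /\ c = -1.
Proof.
move=> e; have /mul_eqN1 : d * (- c) = -1 by rewrite mulrN e.
by move=> [[? ?]|[? ?]]; [left|right]; split; lia.
Qed.

(** In d c = 8 W the powers of 2 cannot be shared as 2 and 4, by [torsor_mod4]. *)
Lemma dual_torsor_odd (d c W : int) : ~~ (2 %| W)%Z -> d * c = 8 * W -> torsor d c ->
  (exists2 c', c = 8 * c' & d * c' = W) \/ (exists2 d', d = 8 * d' & d' * c = W).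
Proof.
move=> oW e tor; have tor' := torsor_sym tor.
have no24 d' c' x y : torsor d' c' -> d' = 2 * x -> c' = 2 * (2 * y) -> x * y = W -> False.
  move=> t ed ec exy; have ox : ~~ (2 %| x)%Z.
    by apply: contra oW => h; rewrite -exy dvdz_mulr.
  have d4 : ~~ (4 %| d')%Z by rewrite ed; clear -ox; lia.
  by apply: (torsor_mod4 _ d4 _ t); rewrite ?ed ?ec ?mulrA dvdz_mulr.
have e2 : d * c = 2%N%:Z * (2 * (2 * W)) by rewrite e; ring.
have [[d1 ed e3]|[c1 ec e3]] := @split_prime 2 _ _ _ isT e2;
have [[d2 ed2 e4]|[c2 ec2 e4]] := @split_prime 2 _ _ _ isT e3;
have [[d3 ed3 e5]|[c3 ec3 e5]] := @split_prime 2 _ _ _ isT e4.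
- by right; exists d3 => //; rewrite ed ed2 ed3; ring.
- by case: (no24 c d c3 d2) => //; [rewrite ed ed2|rewrite mulrC].
- by case: (no24 c d c2 d3) => //; [rewrite ed ed3|rewrite mulrC].
- by case: (no24 d c d1 c3) => //; rewrite ec2 ec3.
- by case: (no24 c d c1 d3) => //; [rewrite ed2 ed3|rewrite mulrC].
- by case: (no24 d c d2 c3) => //; rewrite ec ec3.
- by case: (no24 d c d3 c2) => //; rewrite ec ec2.
by left; exists c3 => //; rewrite ec ec2 ec3; ring.
Qed.

Lemma QR_divide4 (p : nat) (c : int) : odd p -> QR (4 * c) p -> QR c p.
Proof.
move=> op [z hz].
have co4 : coprimez p%:Z 4 by rewrite coprimezE absz_nat -[absz 4]/(2 ^ 2)%N coprimeXr // coprimen2.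
suff [w hw] : exists w : int, (p%:Z %| (2 * w) ^+ 2 - 4 * c)%Z.
  exists w; rewrite -(Gauss_dvdzr _ co4).
  by have -> : 4 * (w ^+ 2 - c) = (2 * w) ^+ 2 - 4 * c by ring.
have [/dvdzP [w ew]|oz] := boolP (2 %| z)%Z; first by exists w; rewrite mulrC -ew.
have [w ew] : exists w, z + p%:Z = 2 * w by exists ((z + p%:Z) %/ 2)%Z; lia.
exists w; rewrite -ew.
have -> : (z + p%:Z) ^+ 2 - 4 * c = (z ^+ 2 - 4 * c) + (2 * z + p%:Z) * p%:Z by ring.
by rewrite rpredD // dvdz_mull.
Qed.

(** One of the two coefficients is odd; being positive it is 1, p, q or pq, and it is
    1 modulo 8.  This leaves 1 and pq, and for pq the number 8 would be a square modulo
    both primes, one of which is 3 or 5 modulo 8. *)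
Lemma dual_selmer (p q : nat) (d c : int) : prime p -> prime q ->
  (p %% 8)%N \in [:: 3; 5; 7]%N -> (q %% 8)%N \in [:: 3; 5; 7]%N ->
  ((p %% 8)%N \in [:: 3; 5]%N) || ((q %% 8)%N \in [:: 3; 5]%N) ->
  d * c = 8 * (p%:Z * q%:Z) -> torsor d c -> d = 1 \/ c = 1.
Proof.
move=> pp pq p8 q8 pq8 e.
have op : odd p by apply: odd_mod8 p8.
have oq : odd q by apply: odd_mod8 q8.
have pq0 : 0 < p%:Z * q%:Z by rewrite mulr_gt0 ?ltz_nat ?prime_gt0.
have odd_pq : ~~ (2 %| p%:Z * q%:Z)%Z by rewrite -PoszM dvdzE absz_nat dvdn2 oddM op oq.
have main D C : torsor D (8 * C) -> D * C = p%:Z * q%:Z -> D = 1.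
  move=> t eDC; have D0 : 0 < D.
    by apply: torsor_pos t; rewrite mulrCA eDC mulr_gt0.
  have oD : ~~ (2 %| D)%Z by apply: contra odd_pq => h; rewrite -eDC dvdz_mulr.
  have [k hk] : exists k, D = 8 * k + 1.
    have [|k [h|h]] := torsor_mod8 _ oD t; first by rewrite dvdz_mulr.
      by exists k.
    by exists (k - C); lia.
  have e1 : D * C = p%:Z * (q%:Z * 1) by rewrite eDC mulr1.
  have np (r : nat) : (r %% 8)%N \in [:: 3; 5; 7]%N -> D <> r%:Z.
    by rewrite !inE => h eD; lia.
  have p0 : 0 < p%:Z by rewrite ltz_nat prime_gt0.
  have q0 : 0 < q%:Z by rewrite ltz_nat prime_gt0.
  have [[x ex e2]|[x ex e2]] := split_prime pp e1;
  have [[y ey e3]|[y ey e3]] := split_prime pq e2;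
  have h1 := mul_eq1 e3.
  - have y1 : y = 1 /\ C = 1.
      case: h1 => // -[ey' _]; move: D0; rewrite ex ey ey' mulrA pmulr_rgt0 //.
    case: y1 => y1 C1; rewrite C1 in t.
    case/orP: pq8 => [p35|q35].
      case: (nonresidue2 pp p35); apply: (QR_divide4 op).
      by apply: torsor_QR (torsor_sym t); rewrite // ex dvdz_mulr.
    case: (nonresidue2 pq q35); apply: (QR_divide4 oq).
    by apply: torsor_QR (torsor_sym t); rewrite // ex ey mulrCA dvdz_mulr.
  - case: h1 => -[x1 _]; first by case: (np p p8); rewrite ex x1 mulr1.
    by move: D0; rewrite ex x1 pmulr_rgt0.
  - case: h1 => -[y1 _]; first by case: (np q q8); rewrite ey y1 mulr1.
    by move: D0; rewrite ey y1 pmulr_rgt0.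
  by case: h1 => -[D1 _] //; rewrite D1 in D0.
move=> t; have [[c' ec ec']|[d' ed ed']] := dual_torsor_odd odd_pq e t.
  by left; apply: (main d c') => //; rewrite -ec.
by right; apply: (main c d'); [rewrite -ed; apply: torsor_sym|rewrite mulrC].
Qed.

(** * From Selmer data to rank one *)

Lemma nonsquare_int (l : nat) (k : int) : prime l -> (l%:Z %| k)%Z ->
  ~~ ((l ^ 2)%N%:Z %| k)%Z -> ~ is_square k%:~R.
Proof.
move=> pl lk l2k [w ew]; have [m em] := rat_sqrt_int (esym ew).
have {em ew w} ek : k = m ^+ 2.
  by apply/eqP; rewrite -(eqr_int rat) rmorphXn /= -em ew.
move/negP: l2k; apply; move: lk; rewrite ek !dvdzE !absz_nat abszX Euclid_dvdX //.
by rewrite andbT => h; apply: dvdn_exp2r.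
Qed.

(** The valuation at l is one. *)
Lemma nonsquare_prime_mul (l : nat) (k : int) : prime l -> ~~ (l%:Z %| k)%Z ->
  ~ is_square (l%:Z * k)%:~R.
Proof.
move=> pl lk; apply: (nonsquare_int pl); first by rewrite dvdz_mulr.
by rewrite -mulnn PoszM dvdz_mul2l //; have := prime_gt0 pl; lia.
Qed.

Lemma nonsquare_neg (k : int) : k < 0 -> ~ is_square k%:~R.
Proof.
move=> k0 [w ew]; have : 0 <= k%:~R :> rat by rewrite ew sqr_ge0.
by rewrite ler0z leNgt k0.
Qed.

(** The quartic with coefficients D and C supplies the point R, with
    x = D (M0 / e0)^2. *)
Lemma rank_one_of_selmer (p q : nat) (D C M0 e0 m : int) :
  prime p -> prime q -> odd p -> p <> q ->
  D * C = - (2 * p%:Z * q%:Z) -> M0 != 0 -> e0 != 0 ->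
  D * M0 ^+ 4 + C * e0 ^+ 4 = m ^+ 2 ->
  (forall d c, d * c = 8 * (p%:Z * q%:Z) -> torsor d c -> d = 1 \/ c = 1) ->
  (forall d c, d * c = - (2 * p%:Z * q%:Z) -> torsor d c ->
     [\/ d = 1, c = 1, d = D | c = D]) ->
  ~ is_square D%:~R -> ~ is_square (- (2 * p%:Z * q%:Z) * D)%:~R ->
  has_rank (- (2 * p%:R * q%:R)) 0 1.
Proof.
move=> pp pq op npq eDC M00 e00 em Hdual Hsel nD naD.
pose N := (2 * p * q)%N.
have N0 : (0 < N)%N by rewrite !muln_gt0 !prime_gt0.
have -> : - (2 * p%:R * q%:R) = - N%:R :> rat by rewrite /N !natrM.
have aE : - N%:R = (- (2 * p%:Z * q%:Z))%:~R :> rat.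
  by rewrite rmorphN !rmorphM /= /N !natrM.
have NE : N%:R = (2 * p%:Z * q%:Z)%:~R :> rat by rewrite !rmorphM /= /N !natrM.
have pN : ~ is_square (N%:R : rat).
  rewrite (_ : N%:R = (p%:Z * (2 * q%:Z))%:~R); last first.
    by rewrite NE; congr (_%:~R); ring.
  apply: nonsquare_prime_mul => //; rewrite dvdzE abszM !absz_nat Euclid_dvdM //.
  rewrite !dvdn_prime2 // negb_or; apply/andP; split; last exact/eqP.
  by apply/eqP => p2; rewrite p2 in op.
have D0 : D != 0 by apply/eqP => D_0; apply: nD; rewrite D_0; exists 0; rewrite expr0n.
have D0' : D%:~R != 0 :> rat by rewrite intr_eq0.
have M00' : M0%:~R != 0 :> rat by rewrite intr_eq0.
have e00' : e0%:~R != 0 :> rat by rewrite intr_eq0.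
pose s : rat := M0%:~R / e0%:~R.
have s0 : s != 0 by rewrite mulf_neq0 ?invr_eq0.
have emR : D%:~R * M0%:~R ^+ 4 + C%:~R * e0%:~R ^+ 4 = m%:~R ^+ 2 :> rat.
  by rewrite -!rmorphXn -!rmorphM -rmorphD /= em.
have hR : on_curve (- N%:R) 0 (Some (D%:~R * s ^+ 2, D%:~R * M0%:~R * m%:~R / e0%:~R ^+ 3)).
  apply/eqP; rewrite aE -eDC rmorphM /= /s addr0 expr_div_n exprMn -emR.
  by field.
pose R : mw_group (nonsingularN N0) := Point hR.
have aR : alpha R = D%:~R * s ^+ 2.
  by rewrite /alpha /= mulf_eq0 expf_eq0 /= (negPf D0') (negPf s0).
apply: (rank_one_criterion (N_gt0 := N0) _ (R := R)).
- by move=> x; apply/eqP => ex; apply: pN; exists x.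
- move=> x y x0 exy.
  have [||d [c [M [e [n [edc e1 ex en [h1 h2 h3]]]]]]] :=
    @torsor_of_point (8 * (p%:Z * q%:Z)) x y _ x0 _.
  + by rewrite !mulf_neq0 // eqz_nat -lt0n prime_gt0.
  + by rewrite exy; congr (_ + _ * _); rewrite NE !intrM; ring.
  have tor : torsor d c by exists M, e, n.
  have [d1|c1] := Hdual d c edc tor; [left|right]; rewrite ex.
    by rewrite d1 mul1r; apply: is_square_sqr.
  rewrite mulrA; apply: is_squareM (is_square_sqr _).
  exists (4 * (p%:Z * q%:Z))%:~R.
  move: edc; rewrite c1 mulr1 => ->; by rewrite NE !intrM; ring.
- move=> x y x0 exy.
  have [||d [c [M [e [n [edc e1 ex en [h1 h2 h3]]]]]]] :=
    @torsor_of_point (- (2 * p%:Z * q%:Z)) x y _ x0 _.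
  + by rewrite oppr_eq0 !mulf_neq0 // eqz_nat -lt0n prime_gt0.
  + by rewrite exy -mulNr aE.
  have tor : torsor d c by exists M, e, n.
  have sq := is_square_sqr (M%:~R / e%:~R : rat).
  rewrite aR aE -edc ex; have [e2|e2|e2|e2] := Hsel d c edc tor.
  + by apply: Or41; rewrite e2 mul1r.
  + apply: Or42; rewrite mulrA e2 mulr1; apply: is_squareM => //.
    by exists d%:~R; rewrite expr2.
  + apply: Or43; rewrite e2 mulrACA; apply: is_squareM; first by exists D%:~R; rewrite expr2.
    exact: is_squareM (is_square_sqr _) sq.
  apply: Or44; rewrite e2.
  have -> : (d * D)%:~R * (D%:~R * s ^+ 2 * (d%:~R * (M%:~R / e%:~R) ^+ 2)) =
     (d%:~R * D%:~R) ^+ 2 * (s ^+ 2 * (M%:~R / e%:~R) ^+ 2) :> rat by rewrite intrM; ring.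
  by apply: is_squareM (is_square_sqr _) (is_squareM (is_square_sqr _) sq).
- rewrite aR mulrC => h; apply: nD; apply: is_square_cancel (is_square_sqr s) h.
  by rewrite expf_neq0.
rewrite aR aE mulrA mulrC => h; apply: naD; rewrite rmorphM.
by apply: is_square_cancel (is_square_sqr s) h; rewrite expf_neq0.
Qed.

(** * The residue classes modulo 8 *)

Lemma QR_cancel (p : nat) (a b : int) : prime p -> ~~ (p%:Z %| a)%Z ->
  QR a p -> QR (a * b) p -> QR b p.
Proof.
move=> pp pa [z hz] [w hw].
have pz : ~~ (p%:Z %| z)%Z.
  apply: contra pa => h; have -> : a = z ^+ 2 - (z ^+ 2 - a) by ring.
  by rewrite rpredB // expr2 dvdz_mulr.
have : coprimez z p%:Z.
  by move: pz; rewrite coprimez_sym coprimezE dvdzE absz_nat -prime_coprime.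
move/coprimezP => [[u v] /= uv]; exists (w * u).
have vp : v * p%:Z = 1 - u * z by rewrite -uv addrAC subrr add0r.
have -> : (w * u) ^+ 2 - b = (w ^+ 2 - a * b) * u ^+ 2 - (z ^+ 2 - a) * (b * u ^+ 2)
   - b * (1 + u * z) * (1 - u * z) by ring.
rewrite -vp; apply: rpredB; last by rewrite mulrA dvdz_mull.
by apply: rpredB; apply: dvdz_mulr.
Qed.

Section Cases.
Variables p q : nat.
Hypotheses (pp : prime p) (pq : prime q).

Lemma selmer_from_cases D0 :
  (forall D C : int, torsor D C ->
   torsor_candidate p q D C -> D = 1 \/ D = D0) ->
  forall d c, d * c = - (2 * p%:Z * q%:Z) -> torsor d c ->
     [\/ d = 1, c = 1, d = D0 | c = D0].
Proof.
move=> h d c e t; have [D [C [t' dD hD]]] := torsor_cases pp pq e t.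
by have [e1|e1] := h D C t' hD; case: dD => e2; subst;
  [apply: Or41|apply: Or42|apply: Or43|apply: Or44].
Qed.

Lemma torsorN1_QR C : torsor (-1) C -> C = 2 * p%:Z * q%:Z ->
  QR (-1) p /\ QR (-1) q.
Proof.
move=> t eC; split; apply: torsor_QR t; rewrite // eC.
  by rewrite mulrAC dvdz_mull.
by rewrite dvdz_mull.
Qed.

Lemma torsor2_QR D C : torsor D C -> C = - (p%:Z * q%:Z) \/ C = p%:Z * q%:Z ->
  QR D p /\ QR D q.
Proof.
move=> t eC; split; apply: torsor_QR t => //.
  by case: eC => ->; rewrite ?rpredN dvdz_mulr.
by case: eC => ->; rewrite ?rpredN dvdz_mull.
Qed.
End Cases.

Lemma prime_not_dvd (p q : nat) i j : prime p -> prime q -> odd p -> p <> q ->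
  ~~ (p%:Z %| 2 ^+ i * q%:Z ^+ j)%Z.
Proof.
move=> pp pq op npq; rewrite dvdzE abszM !abszX !absz_nat Euclid_dvdM //.
rewrite negb_or !Euclid_dvdX // !negb_and !dvdn_prime2 //.
apply/andP; split; apply/orP; left; last exact/eqP.
by apply/eqP => p2; rewrite p2 in op.
Qed.

Lemma torsor_mod8_no d c : torsor d c -> (2 %| c)%Z -> ~~ (2 %| d)%Z ->
  (d %% 8)%Z != 1 -> ((d + c) %% 8)%Z != 1 -> False.
Proof. by move=> t c2 d2 h1 h2; have [k] := torsor_mod8 c2 d2 t; lia. Qed.

(** The solution is M = 2, e = 1 for D = -2.  The values 1, -2 exhaust the candidates:
    -1 and 2 are not squares modulo p, and the others fail modulo 8. *)
Lemma rank_33 (p q : nat) : prime p -> prime q -> p <> q ->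
  (p = 3 %[mod 8])%N -> (q = 3 %[mod 8])%N ->
  perfect_square (p%:Z * q%:Z - 32) -> has_rank (- (2 * p%:R * q%:R)) 0 1.
Proof.
move=> pp pq npq p8 q8 [m em].
have op : odd p by apply: (@odd_mod8 p [:: 3]%N); rewrite // p8.
apply: (@rank_one_of_selmer p q (-2) (p%:Z * q%:Z) 2 1 m) => //.
- by ring.
- by rewrite -em; ring.
- by move=> d c; apply: dual_selmer; rewrite ?p8 ?q8.
- apply: selmer_from_cases => // D C t.
  case=> [h|[h1 h2]|[h1 h2]|]; first by left.
  + by rewrite h1 in t; case: (nonresidueN1 pp _ (proj1 (torsorN1_QR pp pq t h2))); rewrite p8.
  + by case: (nonresidue2 pp _); rewrite ?p8 // -h1; case: (torsor2_QR pp pq t (or_introl h2)).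
  case=> [[h1 h2]|[h1 h2]|[h1 h2]|[[h1 h2]|[h1 h2]]]; first by right.
  + case: (torsor_mod8_no t); rewrite ?h1 ?h2; lia.
  + case: (torsor_mod8_no t); rewrite ?h1 ?h2; lia.
  + case: (torsor_mod8_no t); rewrite ?h1 ?h2; lia.
  case: (torsor_mod8_no t); rewrite ?h1 ?h2; lia.
- exact: nonsquare_neg.
have -> : - (2 * p%:Z * q%:Z) * -2 = p%:Z * (2 ^+ 2 * q%:Z ^+ 1) by ring.
by apply: nonsquare_prime_mul => //; apply: prime_not_dvd.
Qed.

(** The solution is M = e = 1 for D = -1; both 2 and -2 are nonresidues modulo p,
    and the other candidates fail modulo 8. *)
Lemma rank_55 (p q : nat) : prime p -> prime q -> p <> q ->
  (p = 5 %[mod 8])%N -> (q = 5 %[mod 8])%N ->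
  perfect_square (2 * p%:Z * q%:Z - 1) -> has_rank (- (2 * p%:R * q%:R)) 0 1.
Proof.
move=> pp pq npq p8 q8 [m em].
have op : odd p by apply: (@odd_mod8 p [:: 5]%N); rewrite // p8.
apply: (@rank_one_of_selmer p q (-1) (2 * p%:Z * q%:Z) 1 1 m) => //.
- by ring.
- by rewrite -em; ring.
- by move=> d c; apply: dual_selmer; rewrite ?p8 ?q8.
- apply: selmer_from_cases => // D C t.
  case=> [h|[h1 h2]|[h1 h2]|]; first by left.
  + by right.
  + by case: (nonresidue2 pp _); rewrite ?p8 // -h1; case: (torsor2_QR pp pq t (or_introl h2)).
  case=> [[h1 h2]|[h1 h2]|[h1 h2]|[[h1 h2]|[h1 h2]]].
  + by case: (nonresidueN2 pp _); rewrite ?p8 // -h1; case: (torsor2_QR pp pq t (or_intror h2)).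
  + case: (torsor_mod8_no t); rewrite ?h1 ?h2; lia.
  + case: (torsor_mod8_no t); rewrite ?h1 ?h2; lia.
  + case: (torsor_mod8_no t); rewrite ?h1 ?h2; lia.
  case: (torsor_mod8_no t); rewrite ?h1 ?h2; lia.
- exact: nonsquare_neg.
have -> : - (2 * p%:Z * q%:Z) * -1 = p%:Z * (2 ^+ 1 * q%:Z ^+ 1) by ring.
by apply: nonsquare_prime_mul => //; apply: prime_not_dvd.
Qed.

Lemma nonsquare_prime (p : nat) : prime p -> ~ is_square p%:Z%:~R.
Proof.
move=> pp; rewrite -[p%:Z]mulr1; apply: nonsquare_prime_mul => //.
by rewrite dvdz1 absz_nat; apply/eqP => p1; rewrite p1 in pp.
Qed.

(** Local conditions leave D = p, which needs p to be a square modulo q, and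
    D = - q, which needs 2p to be one.  These exclude each other as 2 is not, and the
    perfect square tells which one holds. *)
Lemma rank_35 (p q : nat) : prime p -> prime q -> p <> q ->
  (p = 3 %[mod 8])%N -> (q = 5 %[mod 8])%N ->
  perfect_square (p%:Z - 2 * q%:Z) \/ perfect_square (2 * p%:Z - q%:Z) ->
  has_rank (- (2 * p%:R * q%:R)) 0 1.
Proof.
move=> pp pq npq p8 q8 sq.
have op : odd p by apply: (@odd_mod8 p [:: 3]%N); rewrite // p8.
have p0 := prime_gt0 pp; have q0 := prime_gt0 pq.
have dual d c : d * c = 8 * (p%:Z * q%:Z) -> torsor d c -> d = 1 \/ c = 1.
  by apply: dual_selmer; rewrite ?p8 ?q8.
have qp : ~~ (q%:Z %| p%:Z)%Z.
  by rewrite dvdzE !absz_nat dvdn_prime2 //; apply/eqP => e; rewrite e in npq.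
have cases D C : torsor D C ->
   torsor_candidate p q D C ->
   [\/ D = 1, D = p%:Z /\ QR p%:Z q | D = - q%:Z /\ QR (2 * p%:Z) q].
  move=> t; case=> [h|[h1 h2]|[h1 h2]|]; first by apply: Or31.
  + by rewrite h1 in t; case: (nonresidueN1 pp _ (proj1 (torsorN1_QR pp pq t h2))); rewrite p8.
  + by case: (nonresidue2 pp _); rewrite ?p8 // -h1; case: (torsor2_QR pp pq t (or_introl h2)).
  case=> [[h1 h2]|[h1 h2]|[h1 h2]|[[h1 h2]|[h1 h2]]].
  + by case: (nonresidueN2 pq _); rewrite ?q8 // -h1; case: (torsor2_QR pp pq t (or_intror h2)).
  + apply: Or32; split => //; rewrite -h1; apply: torsor_QR t => //.
    by rewrite h2 rpredN dvdz_mull.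
  + case: (torsor_mod8_no t); rewrite ?h1 ?h2; lia.
  + case: (torsor_mod8_no t); rewrite ?h1 ?h2; lia.
  apply: Or33; split => //; rewrite -h2; apply: torsor_QR (torsor_sym t) => //.
  by rewrite h1 rpredN.
case: sq => [[m em]|[m em]].
- apply: (@rank_one_of_selmer p q p%:Z (- (2 * q%:Z)) 1 1 m) => //.
  + by ring.
  + by rewrite -em; ring.
  + apply: selmer_from_cases => // D C t /(cases _ _ t) [h|[h _]|[_ h]]; [by left|by right|].
    case: (nonresidue2 pq _); first by rewrite q8.
    apply: (QR_cancel pq qp); last by rewrite mulrC.
    by exists m; rewrite -em; apply/dvdzP; exists (-2); ring.
  + exact: nonsquare_prime.
  by apply: nonsquare_neg; rewrite mulNr oppr_lt0 !mulr_gt0 // ltz_nat.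
apply: (@rank_one_of_selmer p q (- q%:Z) (2 * p%:Z) 1 1 m) => //.
- by ring.
- by rewrite -em; ring.
- apply: selmer_from_cases => // D C t /(cases _ _ t) [h|[_ h]|[h _]]; [by left| |by right].
  case: (nonresidue2 pq _); first by rewrite q8.
  apply: (QR_cancel pq qp) => //; rewrite mulrC.
  by exists m; rewrite -em; apply/dvdzP; exists (-1); ring.
- by apply: nonsquare_neg; lia.
have -> : - (2 * p%:Z * q%:Z) * - q%:Z = p%:Z * (2 ^+ 1 * q%:Z ^+ 2) by ring.
by apply: nonsquare_prime_mul => //; apply: prime_not_dvd.
Qed.

(** Local conditions leave D = q, which needs q to be a square modulo p, and
    D = - q, which needs - q to be one.  These exclude each other as -1 is not, and the
    perfect square tells which one holds; 32 p - q comes from e = 2. *)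
Lemma rank_37 (p q : nat) : prime p -> prime q -> p <> q ->
  (p = 3 %[mod 8])%N -> (q = 7 %[mod 8])%N ->
  perfect_square (32 * p%:Z - q%:Z) \/ perfect_square (q%:Z - 2 * p%:Z) ->
  has_rank (- (2 * p%:R * q%:R)) 0 1.
Proof.
move=> pp pq npq p8 q8 sq.
have op : odd p by apply: (@odd_mod8 p [:: 3]%N); rewrite // p8.
have p0 := prime_gt0 pp; have q0 := prime_gt0 pq.
have dual d c : d * c = 8 * (p%:Z * q%:Z) -> torsor d c -> d = 1 \/ c = 1.
  by apply: dual_selmer; rewrite ?p8 ?q8.
have nN1 : ~ QR (-1) p by apply: nonresidueN1; rewrite ?p8.
have not_both : QR q%:Z p -> QR (- q%:Z) p -> False.
  have pnq : ~~ (p%:Z %| q%:Z)%Z by rewrite dvdzE !absz_nat dvdn_prime2 //; apply/eqP.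
  by move=> h h'; apply: nN1; apply: (QR_cancel pp pnq) => //; rewrite mulrN1.
have cases D C : torsor D C -> torsor_candidate p q D C ->
   [\/ D = 1, D = q%:Z /\ QR q%:Z p | D = - q%:Z /\ QR (- q%:Z) p].
  move=> t; case=> [h|[h1 h2]|[h1 h2]|]; first by apply: Or31.
  + by rewrite h1 in t; case: (nN1 (proj1 (torsorN1_QR pp pq t h2))).
  + by case: (nonresidue2 pp _); rewrite ?p8 // -h1; case: (torsor2_QR pp pq t (or_introl h2)).
  case=> [[h1 h2]|[h1 h2]|[h1 h2]|[[h1 h2]|[h1 h2]]].
  + by case: (nonresidueN2 pq _); rewrite ?q8 // -h1; case: (torsor2_QR pp pq t (or_intror h2)).
  + case: (torsor_mod8_no t); rewrite ?h1 ?h2; lia.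
  + case: (torsor_mod8_no t); rewrite ?h1 ?h2; lia.
  + apply: Or32; split => //; rewrite -h1; apply: torsor_QR t => //.
    by rewrite h2 rpredN dvdz_mull.
  apply: Or33; split => //; rewrite -h1; apply: torsor_QR t => //.
  by rewrite h2 dvdz_mull.
case: sq => [[m em]|[m em]].
- apply: (@rank_one_of_selmer p q (- q%:Z) (2 * p%:Z) 1 2 m) => //.
  + by ring.
  + by rewrite -em; ring.
  + apply: selmer_from_cases => // D C t /(cases _ _ t) [h|[_ h]|[h _]]; [by left| |by right].
    case: not_both => //; exists m; rewrite -em; apply/dvdzP; exists 32; ring.
  + by apply: nonsquare_neg; lia.
  have -> : - (2 * p%:Z * q%:Z) * - q%:Z = p%:Z * (2 ^+ 1 * q%:Z ^+ 2) by ring.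
  by apply: nonsquare_prime_mul => //; apply: prime_not_dvd.
apply: (@rank_one_of_selmer p q q%:Z (- (2 * p%:Z)) 1 1 m) => //.
- by ring.
- by rewrite -em; ring.
- apply: selmer_from_cases => // D C t /(cases _ _ t) [h|[h _]|[_ h]]; [by left|by right|].
  case: not_both => //; exists m; rewrite -em; apply/dvdzP; exists (-2); ring.
- exact: nonsquare_prime.
by apply: nonsquare_neg; rewrite mulNr oppr_lt0 !mulr_gt0 // ltz_nat.
Qed.

(** Local conditions leave D = - p, which needs 2q to be a square modulo p, and
    D = - q, which needs - q to be one.  These exclude each other as -2 is not, and the
    perfect square tells which one holds; 32 p - q comes from e = 2. *)
Lemma rank_57 (p q : nat) : prime p -> prime q -> p <> q ->
  (p = 5 %[mod 8])%N -> (q = 7 %[mod 8])%N ->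
  perfect_square (32 * p%:Z - q%:Z) \/ perfect_square (2 * q%:Z - p%:Z) ->
  has_rank (- (2 * p%:R * q%:R)) 0 1.
Proof.
move=> pp pq npq p8 q8 sq.
have op : odd p by apply: (@odd_mod8 p [:: 5]%N); rewrite // p8.
have oq : odd q by apply: (@odd_mod8 q [:: 7]%N); rewrite // q8.
have p0 := prime_gt0 pp; have q0 := prime_gt0 pq.
have dual d c : d * c = 8 * (p%:Z * q%:Z) -> torsor d c -> d = 1 \/ c = 1.
  by apply: dual_selmer; rewrite ?p8 ?q8.
have not_both : QR (- q%:Z) p -> QR (2 * q%:Z) p -> False.
  have pnq : ~~ (p%:Z %| - q%:Z)%Z.
    by rewrite rpredN dvdzE !absz_nat dvdn_prime2 //; apply/eqP.
  move=> h h'; case: (nonresidueN2 pp _); first by rewrite p8.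
  by apply: (QR_cancel pp pnq) => //; rewrite mulrNN mulrC.
have cases D C : torsor D C -> torsor_candidate p q D C ->
   [\/ D = 1, D = - p%:Z /\ QR (2 * q%:Z) p | D = - q%:Z /\ QR (- q%:Z) p].
  move=> t; case=> [h|[h1 h2]|[h1 h2]|]; first by apply: Or31.
  + by rewrite h1 in t; case: (nonresidueN1 pq _ (proj2 (torsorN1_QR pp pq t h2))); rewrite q8.
  + by case: (nonresidue2 pp _); rewrite ?p8 // -h1; case: (torsor2_QR pp pq t (or_introl h2)).
  case=> [[h1 h2]|[h1 h2]|[h1 h2]|[[h1 h2]|[h1 h2]]].
  + by case: (nonresidueN2 pp _); rewrite ?p8 // -h1; case: (torsor2_QR pp pq t (or_intror h2)).
  + case: (torsor_mod8_no t); rewrite ?h1 ?h2; lia.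
  + apply: Or32; split => //; rewrite -h2; apply: torsor_QR (torsor_sym t) => //.
    by rewrite h1 rpredN.
  + case: (torsor_mod8_no t); rewrite ?h1 ?h2; lia.
  apply: Or33; split => //; rewrite -h1; apply: torsor_QR t => //.
  by rewrite h2 dvdz_mull.
case: sq => [[m em]|[m em]].
- apply: (@rank_one_of_selmer p q (- q%:Z) (2 * p%:Z) 1 2 m) => //.
  + by ring.
  + by rewrite -em; ring.
  + apply: selmer_from_cases => // D C t /(cases _ _ t) [h|[_ h]|[h _]]; [by left| |by right].
    case: not_both => //; exists m; rewrite -em; apply/dvdzP; exists 32; ring.
  + by apply: nonsquare_neg; lia.
  have -> : - (2 * p%:Z * q%:Z) * - q%:Z = p%:Z * (2 ^+ 1 * q%:Z ^+ 2) by ring.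
  by apply: nonsquare_prime_mul => //; apply: prime_not_dvd.
apply: (@rank_one_of_selmer p q (- p%:Z) (2 * q%:Z) 1 1 m) => //.
- by ring.
- by rewrite -em; ring.
- apply: selmer_from_cases => // D C t /(cases _ _ t) [h|[h _]|[_ h]]; [by left|by right|].
  case: not_both => //; exists m; rewrite -em; apply/dvdzP; exists (-1); ring.
- by apply: nonsquare_neg; lia.
have -> : - (2 * p%:Z * q%:Z) * - p%:Z = q%:Z * (2 ^+ 1 * p%:Z ^+ 2) by ring.
by apply: nonsquare_prime_mul => //; apply: prime_not_dvd => //; apply: nesym.
Qed.

(** * The theorem *)

Theorem theorem1p5 (p q : nat) (hp : prime p) (hq : prime q)
    (op : odd p) (oq : odd q) (hpq : p <> q) :
  (* (i) *)
  ((p = 3 %[mod 8])%N -> (q = 3 %[mod 8])%N ->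
     perfect_square (p%:Z * q%:Z - 32) ->
     (legendre p q = 1 -> has_rank (- (2 * p%:R * q%:R)) 0 1) /\
     (legendre p q = -1 -> has_rank (- (2 * p%:R * q%:R)) 0 1)) /\
  (* (ii) *)
  ((p = 3 %[mod 8])%N -> (q = 5 %[mod 8])%N ->
     (legendre p q = 1 /\ perfect_square (p%:Z - 2 * q%:Z)) \/
     (legendre p q = -1 /\ perfect_square (2 * p%:Z - q%:Z)) ->
     has_rank (- (2 * p%:R * q%:R)) 0 1) /\
  (* (iii) *)
  ((p = 5 %[mod 8])%N -> (q = 3 %[mod 8])%N ->
     (legendre p q = 1 /\ perfect_square (q%:Z - 2 * p%:Z)) \/
     (legendre p q = -1 /\ perfect_square (2 * q%:Z - p%:Z)) ->
     has_rank (- (2 * p%:R * q%:R)) 0 1) /\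
  (* (iv) *)
  ((p = 3 %[mod 8])%N -> (q = 7 %[mod 8])%N ->
     (legendre p q = 1 /\ perfect_square (32 * p%:Z - q%:Z)) \/
     (legendre p q = -1 /\ perfect_square (q%:Z - 2 * p%:Z)) ->
     has_rank (- (2 * p%:R * q%:R)) 0 1) /\
  (* (v) *)
  ((p = 7 %[mod 8])%N -> (q = 3 %[mod 8])%N ->
     (legendre p q = 1 /\ perfect_square (p%:Z - 2 * q%:Z)) \/
     (legendre p q = -1 /\ perfect_square (32 * q%:Z - p%:Z)) ->
     has_rank (- (2 * p%:R * q%:R)) 0 1) /\
  (* (vi) *)
  ((p = 5 %[mod 8])%N -> (q = 7 %[mod 8])%N ->
     (legendre p q = 1 /\ perfect_square (32 * p%:Z - q%:Z)) \/
     (legendre p q = -1 /\ perfect_square (2 * q%:Z - p%:Z)) ->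
     has_rank (- (2 * p%:R * q%:R)) 0 1) /\
  (* (vii) *)
  ((p = 7 %[mod 8])%N -> (q = 5 %[mod 8])%N ->
     (legendre p q = 1 /\ perfect_square (32 * q%:Z - p%:Z)) \/
     (legendre p q = -1 /\ perfect_square (2 * p%:Z - q%:Z)) ->
     has_rank (- (2 * p%:R * q%:R)) 0 1) /\
  (* (viii) *)
  ((p = 5 %[mod 8])%N -> (q = 5 %[mod 8])%N ->
     perfect_square (2 * p%:Z * q%:Z - 1) ->
     (legendre p q = 1 -> has_rank (- (2 * p%:R * q%:R)) 0 1) /\
     (legendre p q = -1 -> has_rank (- (2 * p%:R * q%:R)) 0 1)).
Proof.
have swap : - (2 * p%:R * q%:R) = - (2 * q%:R * p%:R) :> rat by rewrite mulrAC.
have hqp : q <> p by move=> e; apply: hpq.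
split; first by move=> p8 q8 sq; split=> _; apply: rank_33.
split.
  move=> p8 q8 sq; apply: rank_35 => //.
  by case: sq => -[_ sq]; [left|right].
split.
  move=> p8 q8 sq; rewrite swap; apply: rank_35 => //.
  by case: sq => -[_ sq]; [left|right].
split.
  move=> p8 q8 sq; apply: rank_37 => //.
  by case: sq => -[_ sq]; [left|right].
split.
  move=> p8 q8 sq; rewrite swap; apply: rank_37 => //.
  by case: sq => -[_ sq]; [right|left].
split.
  move=> p8 q8 sq; apply: rank_57 => //.
  by case: sq => -[_ sq]; [left|right].
split; last by move=> p8 q8 sq; split=> _; apply: rank_55.
move=> p8 q8 sq; rewrite swap; apply: rank_57 => //.
by case: sq => -[_ sq]; [left|right].
Qed.
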